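(* Let $\pi\colon E\to\mathbb{R}$ be a fibre bundle and $L\in C^\infty(J^1\pi)$ a Lagrangian admitting a Hamiltonian section. Let $\{\phi_I\}=\{\phi_a,\phi_\alpha\}$ be a complete set of independent primary Hamiltonian constraints, with $\{\phi_a\}$ first class and $\{\phi_\alpha\}$ second class (at primary level), and let $h_0$ be a Hamiltonian section for $L$ in which the multipliers of the second class primary constraints have been fixed, i.e. $\mathcal{L}_{X_{h_0}}\phi_\alpha=0$ on $S_H^1$ for all $\alpha$. Then there are functions $\nu^a\in C^\infty(J^1\pi)$, which are not $\mathcal{F}_L$-projectable, such that for every function $G\in C^\infty(J^1\pi^* )$, $$K\cdot G=\widehat{\mathcal F}_L^*\{\mu^*G,h_0^\star\}_{T^*E}+M^{\beta\alpha}\chi_\alpha\,\mathcal{F}_L^*\{G,\phi_\beta\}_{J^1\pi^*}+\nu^a\,\mathcal{F}_L^*\{G,\phi_a\}_{J^1\pi^*},$$ where $(M^{\alpha\beta})$ is the inverse matrix of $\bigl(\mathcal{F}_L^*\{\phi_\alpha,\phi_\beta\}_{J^1\pi^*}\bigr)$, i.e. $M^{\alpha\beta}\mathcal{F}_L^*\{\phi_\beta,\phi_\gamma\}_{J^1\pi^*}=\delta^\alpha_\gamma$, and $\chi_\alpha=K\cdot\phi_\alpha$ are primary Lagrangian constraints, i.e. vanish on $S_L^1$.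
   Context: Let $\pi\colon E\to\mathbb{R}$ be a fibre bundle, $t$ the coordinate on $\mathbb{R}$, $(t,q^i)$ fibred coordinates on $E$, $(t,q^i,v^i)$ on $J^1\pi$. $J^1\pi^*=\operatorname{Ver}(\pi)^*$ is the dual of the vertical bundle, with coordinates $(t,q^i,p_i)$; $T^*E$ has coordinates $(t,q^i,u,p_i)$ (covector $u\,dt+p_idq^i$), and $\mu\colon T^*E\to J^1\pi^*$ is restriction to vertical vectors. $\{\,,\}_{T^*E}$ is the canonical Poisson bracket (with $\{q^i,p_j\}=\delta^i_j$, $\{t,u\}=1$), and $\{\,,\}_{J^1\pi^*}$ is defined by $\mu^*\{f,g\}_{J^1\pi^*}=\{\mu^*f,\mu^*g\}_{T^*E}$. Repeated indices are summed. Legendre maps: $\mathcal{F}_L(t,q,v)=(t,q^i,\partial L/\partial v^i)\in J^1\pi^*$ and $\widehat{\mathcal F}_L(t,q,v)=(t,q^i,-E_L,\partial L/\partial v^i)\in T^*E$, with $E_L=v^i\frac{\partial L}{\partial v^i}-L$. A function on $J^1\pi$ is $\mathcal{F}_L$-projectable if it is of the form $\mathcal{F}_L^*f$. Time evolution operator: $K\cdot G=\frac{\partial G}{\partial t}\circ\mathcal{F}_L+v^i\Bigl(\frac{\partial G}{\partial q^i}\circ\mathcal{F}_L\Bigr)+\frac{\partial L}{\partial q^i}\Bigl(\frac{\partial G}{\partial p_i}\circ\mathcal{F}_L\Bigr)$ for $G\in C^\infty(J^1\pi^* )$; it is a globally well-defined vector field along $\mathcal{F}_L$. Hamiltonian sections: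 a Hamiltonian section for $L$ is a section $h$ of $\mu$ with $\widehat{\mathcal F}_L=h\circ\mathcal{F}_L$ (assumed to exist). Locally $h(t,q,p)=(t,q,-H(t,q,p),p)$. The function $h^\star\in C^\infty(T^*E)$ is defined by $\alpha-h(\mu(\alpha))=h^\star(\alpha)\,dt$, locally $h^\star=u+H$. The vector field $X_h$ on $J^1\pi^*$ is defined by $\mu^*(\mathcal{L}_{X_h}f)=\{\mu^*f,h^\star\}_{T^*E}$, locally $X_h=\frac{\partial}{\partial t}+\frac{\partial H}{\partial p_i}\frac{\partial}{\partial q^i}-\frac{\partial H}{\partial q^i}\frac{\partial}{\partial p_i}$. Any two Hamiltonian sections for $L$ differ by a function on $J^1\pi^*$ vanishing on $S_H^1$ (the difference being understood via $h'=h+\phi$ iff $h'{}^\star=h^\star+\mu^*\phi$). Constraints: $S_H^1=\mathcal{F}_L(J^1\pi)$, assumed to be a submanifold, defined by the vanishing of a complete set $\{\phi_I\}$ of functionally independent primary Hamiltonian constraints ($\operatorname{rank}\mathcal{F}_L$ constant). At primary level, ''first class'' for $\phi_a$ means $\{\phi_a,\phi_I\}_{J^1\pi^*}=0$ on $S_H^1$ for all $I$, and the second class $\phi_\alpha$ are such that the matrix $\{\phi_\alpha,\phi_\beta\}_{J^1\pi^*}$ is invertible on $S_H^1$. The primary Lagrangian constraint manifold $S_L^1$ is the set of points of $J^1\pi$ at which there exists a tangent vector $\Gamma=\frac{\partial}{\partial t}+v^i\frac{\partial}{\partial q^i}+b^i\frac{\partial}{\partial v^i}$ with $i_\Gamma\Omega_L=0$,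 where $\Omega_L=-d\Theta_L$, $\Theta_L=\frac{\partial L}{\partial v^i}(dq^i-v^idt)+L\,dt$. *)

(* Defs.v *)
From HB Require Import structures.
From mathcomp Require Import all_boot all_order all_algebra.
From mathcomp Require Import all_classical all_reals all_analysis.

Set Implicit Arguments.
Unset Strict Implicit.
Unset Printing Implicit Defensive.

Import Order.TTheory GRing.Theory Num.Theory.
Import numFieldNormedType.Exports.

Local Open Scope classical_set_scope.
Local Open Scope ring_scope.

Section Smooth.
Context {R : realType}.

Definition partial N (i : 'I_N) (f : 'rV[R]_N -> R) (x : 'rV[R]_N) : R :=
  'D_(delta_mx 0 i) f x.

(* Class C^k on U; meant for open U. *)
Fixpoint Ck_on (k : nat) N (U : set 'rV[R]_N) (f : 'rV[R]_N -> R) : Prop :=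
  match k with
  | 0%N => forall x, U x -> {for x, continuous f}
  | k'.+1 => (forall x, U x -> differentiable f x) /\
             (forall i, Ck_on k' U (partial i f))
  end.

Definition smooth_on N (U : set 'rV[R]_N) (f : 'rV[R]_N -> R) : Prop :=
  forall k, Ck_on k U f.

Definition smooth_map_on N M (U : set 'rV[R]_N) (f : 'rV[R]_N -> 'rV[R]_M) :
  Prop := forall j, smooth_on U (fun x => f x 0 j).

End Smooth.

(* A chart c is a homeomorphism mcoord c from the open set mdom c onto an open
   subset of R^n; minv c is its inverse (both are total functions, with
   unspecified values outside).  As part of the structure, a preferred chart
   mchart_at y is fixed around each point y. *)
Record manifold (R : realType) (n : nat) := Manifold {
  mcarrier :> topologicalType;
  mchart : Type;
  mdom : mchart -> set mcarrier;
  mcoord : mchart -> mcarrier -> 'rV[R]_n;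
  minv : mchart -> 'rV[R]_n -> mcarrier;
  mchart_at : mcarrier -> mchart;
  manifold_hausdorff : hausdorff_space mcarrier;
  manifold_second_countable : @second_countable mcarrier;
  mdom_open : forall c, open (mdom c);
  mdom_chart_at : forall y, mdom (mchart_at y) y;
  mcoordK : forall c y, mdom c y -> minv c (mcoord c y) = y;
  mcoord_open : forall c, open (mcoord c @` mdom c);
  mcoord_continuous : forall c, {within mdom c, continuous (mcoord c)};
  minv_continuous : forall c,
    {within mcoord c @` mdom c, continuous (minv c)};
  mtrans_smooth : forall c c',
    smooth_map_on [set x | (mcoord c @` mdom c) x /\ mdom c' (minv c x)]
                  (mcoord c' \o minv c)
}.

(* A smooth fibre bundle bproj : btotal -> R with typical fibre an
   n-dimensional manifold, given by a bundle atlas: a trivialisation k is a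
   homeomorphism e |-> (bproj e, tfib k e) from bproj^-1 (tbase k) onto
   tbase k x bfibre, with inverse (t, y) |-> tinv k t y.  The smooth structure
   of btotal is the one for which the trivialisations are diffeomorphisms;
   triv_smooth says that they are smoothly compatible. *)
Record fibre_bundle (R : realType) (n : nat) := FibreBundle {
  btotal :> topologicalType;
  bfibre : manifold R n;
  bproj : btotal -> R;
  triv : Type;
  tbase : triv -> set R;
  tfib : triv -> btotal -> bfibre;
  tinv : triv -> R -> bfibre -> btotal;
  triv_at : R -> triv;
  bproj_continuous : continuous bproj;
  bproj_surjective : forall t, exists e, bproj e = t;
  tbase_open : forall k, open (tbase k);
  tbase_triv_at : forall t, tbase (triv_at t) t;
  tfibK : forall k e, tbase k (bproj e) -> tinv k (bproj e) (tfib k e) = e;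
  bproj_tinv : forall k t y, tbase k t -> bproj (tinv k t y) = t;
  tfib_tinv : forall k t y, tbase k t -> tfib k (tinv k t y) = y;
  tfib_continuous : forall k,
    {within bproj @^-1` tbase k, continuous (tfib k)};
  tinv_continuous : forall k,
    {within tbase k `*` setT, continuous (fun ty => tinv k ty.1 ty.2)};
  triv_smooth : forall (k k' : triv) (c c' : mchart bfibre),
    smooth_map_on
      [set x : 'rV[R]_(1 + n) |
        let t := x 0 (lshift n 0) in
        let y := minv c (rsubmx x) in
        [/\ tbase k t, tbase k' t,
            (mcoord c @` mdom c) (rsubmx x) &
            mdom c' (tfib k' (tinv k t y))]]
      (fun x => mcoord c' (tfib k' (tinv k (x 0 (lshift n 0))
                                           (minv c (rsubmx x)))))
}.

Section Bundle.
Context {R : realType} {n : nat}.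
Implicit Type B : fibre_bundle R n.

(* Fibred charts (t, q^i) on E: a trivialisation and a chart of the fibre.
   Coordinate vectors are (t, q) : 'rV_(1 + n). *)

Definition fchart B : Type := (triv B * mchart (bfibre B))%type.

Definition fdom B (c : fchart B) : set B :=
  [set e | tbase c.1 (bproj e) /\ mdom c.2 (tfib c.1 e)].

Definition fimg B (c : fchart B) : set 'rV[R]_(1 + n) :=
  [set x : 'rV[R]_(1 + n) | tbase c.1 (x 0 (lshift n 0)) /\
           (mcoord c.2 @` mdom c.2) (rsubmx x)].

Definition fcoord B (c : fchart B) (e : B) : 'rV[R]_(1 + n) :=
  row_mx (bproj e)%:M (mcoord c.2 (tfib c.1 e)).

Definition finv B (c : fchart B) (x : 'rV[R]_(1 + n)) : B :=
  tinv c.1 (x 0 (lshift n 0)) (minv c.2 (rsubmx x)).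

Definition fchart_at B (e : B) : fchart B :=
  (triv_at B (bproj e), mchart_at (tfib (triv_at B (bproj e)) e)).

(* Jacobian matrix, at the point of coordinates x in c, of the change of
   coordinates from c to c'.  The library's 'J acts on row vectors from the
   right: the (i, j) entry is the derivative of the j-th new coordinate with
   respect to the i-th old one. *)
Definition ftransJ B (c c' : fchart B) (x : 'rV[R]_(1 + n)) : 'M[R]_(1 + n) :=
  'J (fcoord c' \o finv c) x.

(* The bundles J^1 pi (jet), J^1 pi^* = Ver(pi)^* (dual) and T^*E (cot).
    As usual for (co)tangent bundles built from an atlas, a point is a pair of
    a point e of E and the components in the preferred chart fchart_at e of
    - the jet at e of a section, i.e. the velocity v of the tangent vector
      d/dt + v^i d/dq^i;
    - a linear form p_i dq^i on the vertical vectors at e;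
    - a covector u dt + p_i dq^i at e, stored as the row (u, p).
    In another chart the components are obtained from the transformation law
    of tangent vectors (resp. covectors, vertical covectors). *)

Definition jet B : Type := (B * 'rV[R]_n)%type.
Definition dual B : Type := (B * 'rV[R]_n)%type.
Definition cot B : Type := (B * 'rV[R]_(1 + n))%type.

(* Coordinates (t, q, v) of a jet; inverse. *)
Definition jet_coord B (c : fchart B) (j : jet B) : 'rV[R]_(1 + n + n) :=
  let c0 := fchart_at j.1 in
  row_mx (fcoord c j.1)
         (rsubmx (row_mx 1%:M j.2 *m ftransJ c0 c (fcoord c0 j.1))).

Definition jet_inv B (c : fchart B) (z : 'rV[R]_(1 + n + n)) : jet B :=
  let e := finv c (lsubmx z) in
  (e, rsubmx (row_mx 1%:M (rsubmx z) *m
              ftransJ c (fchart_at e) (lsubmx z))).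

(* Coordinates (t, q, u, p) of a covector; inverse. *)
Definition cot_coord B (c : fchart B) (a : cot B) :
    'rV[R]_(1 + n + (1 + n)) :=
  row_mx (fcoord c a.1)
         (a.2 *m (ftransJ c (fchart_at a.1) (fcoord c a.1))^T).

Definition cot_inv B (c : fchart B) (z : 'rV[R]_(1 + n + (1 + n))) : cot B :=
  let e := finv c (lsubmx z) in
  let c0 := fchart_at e in
  (e, rsubmx z *m (ftransJ c0 c (fcoord c0 e))^T).

(* Coordinates (t, q, p) of a vertical covector; inverse.  The lower right
   block of the Jacobian matrix is (d q'^j / d q^i). *)
Definition dual_coord B (c : fchart B) (b : dual B) : 'rV[R]_(1 + n + n) :=
  row_mx (fcoord c b.1)
         (b.2 *m (drsubmx (ftransJ c (fchart_at b.1) (fcoord c b.1)))^T).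

Definition dual_inv B (c : fchart B) (z : 'rV[R]_(1 + n + n)) : dual B :=
  let e := finv c (lsubmx z) in
  let c0 := fchart_at e in
  (e, rsubmx z *m (drsubmx (ftransJ c0 c (fcoord c0 e)))^T).

Definition smooth_jet B (f : jet B -> R) : Prop :=
  forall c : fchart B,
    smooth_on [set z | fimg c (lsubmx z)] (f \o jet_inv c).

Definition smooth_dual B (f : dual B -> R) : Prop :=
  forall c : fchart B,
    smooth_on [set z | fimg c (lsubmx z)] (f \o dual_inv c).

(* Restriction of covectors to vertical vectors, mu : T^*E -> J^1 pi^*. *)
Definition mu B (a : cot B) : dual B := (a.1, rsubmx a.2).

(* Here and below, operators given by coordinate formulas are evaluated at a point
   over e in
   the preferred chart at e.
   Canonical bracket: {q^i, p_j} = delta^i_j and {t, u} = 1. *)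
Definition poisson_cot B (f g : cot B -> R) (a : cot B) : R :=
  let c := fchart_at a.1 in
  let z := cot_coord c a in
  let F := f \o cot_inv c in
  let G := g \o cot_inv c in
  \sum_(i < 1 + n)
    (partial (lshift (1 + n) i) F z * partial (rshift (1 + n) i) G z
     - partial (rshift (1 + n) i) F z * partial (lshift (1 + n) i) G z).

(* mu^* {f, g} = {mu^* f, mu^* g}: the right-hand side is constant on the
   fibres of mu, so it may be evaluated at any covector which restricts to b. *)
Definition poisson_dual B (f g : dual B -> R) (b : dual B) : R :=
  poisson_cot (f \o @mu B) (g \o @mu B) (b.1, row_mx 0 b.2).

(* dL/dv^i at the jet of coordinates z in the chart c. *)
Definition momentum B (L : jet B -> R) (c : fchart B) (z : 'rV[R]_(1 + n + n)) :
    'rV[R]_n :=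
  \row_i partial (rshift (1 + n) i) (L \o jet_inv c) z.

Definition legendre B (L : jet B -> R) (j : jet B) : dual B :=
  let c := fchart_at j.1 in (j.1, momentum L c (jet_coord c j)).

Definition energy B (L : jet B -> R) (j : jet B) : R :=
  let c := fchart_at j.1 in
  \sum_i j.2 0 i * momentum L c (jet_coord c j) 0 i - L j.

Definition legendre_hat B (L : jet B -> R) (j : jet B) : cot B :=
  let c := fchart_at j.1 in
  (j.1, row_mx (- energy L j)%:M (momentum L c (jet_coord c j))).

Definition projectable B (L : jet B -> R) (f : jet B -> R) : Prop :=
  exists2 g : dual B -> R, smooth_dual g & f = g \o legendre L.

Definition evolution B (L : jet B -> R) (G : dual B -> R) (j : jet B) : R :=
  let c := fchart_at j.1 in
  let z := jet_coord c j in
  let w := dual_coord c (legendre L j) in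
  let Gc := G \o dual_inv c in
  let Lc := L \o jet_inv c in
  partial (lshift n (lshift n 0)) Gc w
  + \sum_i j.2 0 i * partial (lshift n (rshift 1 i)) Gc w
  + \sum_i partial (lshift n (rshift 1 i)) Lc z
           * partial (rshift (1 + n) i) Gc w.

(* Components, in the chart c, of the one-form
   Theta_L = dL/dv^i (dq^i - v^i dt) + L dt. *)
Definition Theta B (L : jet B -> R) (c : fchart B) (z : 'rV[R]_(1 + n + n)) :
    'rV[R]_(1 + n + n) :=
  row_mx
    (row_mx (L (jet_inv c z)
             - \sum_i rsubmx z 0 i * momentum L c z 0 i)%:M
            (momentum L c z))
    0.

(* Exterior derivative of a one-form: the matrix D with
   (d theta)(X, Y) = \sum_(i, j) D i j X^i Y^j. *)
Definition ext_d N (theta : 'rV[R]_N -> 'rV[R]_N) (z : 'rV[R]_N) : 'M[R]_N :=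
  \matrix_(i, j) (partial i (fun x => theta x 0 j) z
                  - partial j (fun x => theta x 0 i) z).

Definition Omega B (L : jet B -> R) (c : fchart B) (z : 'rV[R]_(1 + n + n)) :
    'M[R]_(1 + n + n) :=
  - ext_d (Theta L c) z.

(* S_L^1: the jets at which i_Gamma Omega_L = 0 for some
   Gamma = d/dt + v^i d/dq^i + b^i d/dv^i. *)
Definition lag_primary B (L : jet B -> R) : set (jet B) :=
  [set j | let c := fchart_at j.1 in
     exists b : 'rV[R]_n,
       row_mx (row_mx 1%:M j.2) b *m Omega L c (jet_coord c j) = 0].

(* S_H^1 *)
Definition ham_primary B (L : jet B -> R) : set (dual B) := range (legendre L).

(* h is a smooth section of mu with FL_hat = h o FL. *)
Definition hamiltonian_section B (L : jet B -> R) (h : dual B -> cot B) : Prop :=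
  [/\ forall b, mu (h b) = b,
      forall c : fchart B,
        smooth_map_on [set z | fimg c (lsubmx z)]
                      (cot_coord c \o h \o dual_inv c) &
      forall j, legendre_hat L j = h (legendre L j)].

(* a - h (mu a) = h_star h a * dt: both covectors lie over the same point and
   dt has components (1, 0) in every fibred chart. *)
Definition h_star B (h : dual B -> cot B) (a : cot B) : R :=
  (a.2 - (h (mu a)).2) 0 (lshift n 0).

(* mu^* (X_h f) = {mu^* f, h_star}: again the right-hand side is constant on
   the fibres of mu; it is evaluated at the covector h b over b. *)
Definition lie_X B (h : dual B -> cot B) (f : dual B -> R) (b : dual B) : R :=
  poisson_cot (f \o @mu B) (h_star h) (h b).

(* Rows: components of the differentials of the phi_I at b. *)
Definition differentials B m (phi : 'I_m -> dual B -> R) (b : dual B) :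
    'M[R]_(m, 1 + n + n) :=
  let c := fchart_at b.1 in
  \matrix_(I, k) partial k (phi I \o dual_inv c) (dual_coord c b).

Definition legendre_rank B (L : jet B -> R) (j : jet B) : nat :=
  let c := fchart_at j.1 in
  \rank ('J (dual_coord c \o legendre L \o jet_inv c) (jet_coord c j)).

(* A complete set of independent primary Hamiltonian constraints: S_H^1 is the
   zero set of the phi_I, their differentials are linearly independent on it,
   and there are as many of them as the (constant) corank of the Legendre
   map. *)
Definition complete_constraints B (L : jet B -> R) m
    (phi : 'I_m -> dual B -> R) : Prop :=
  [/\ forall I, smooth_dual (phi I),
      forall b, ham_primary L b <-> forall I, phi I b = 0,
      forall b, ham_primary L b -> row_free (differentials phi b) &
      forall j, (legendre_rank L j + m = 1 + n + n)%N].

(* The constraints are split as phi = (phi_a, phi_alpha), the first m1 being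
   first class and the last m2 second class (at primary level). *)

Definition first_class B (L : jet B -> R) m1 m2
    (phi : 'I_(m1 + m2) -> dual B -> R) : Prop :=
  forall (a : 'I_m1) (I : 'I_(m1 + m2)) b,
    ham_primary L b -> poisson_dual (phi (lshift m2 a)) (phi I) b = 0.

Definition bracket_matrix B m1 m2 (phi : 'I_(m1 + m2) -> dual B -> R)
    (b : dual B) : 'M[R]_m2 :=
  \matrix_(i, k) poisson_dual (phi (rshift m1 i)) (phi (rshift m1 k)) b.

Definition second_class B (L : jet B -> R) m1 m2
    (phi : 'I_(m1 + m2) -> dual B -> R) : Prop :=
  forall b, ham_primary L b -> bracket_matrix phi b \in unitmx.

End Bundle.

(* Main.v *)
Require Import Defs.
From HB Require Import structures.
From mathcomp Require Import all_boot all_order all_algebra.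
From mathcomp Require Import all_classical all_reals all_analysis ring.
Set Implicit Arguments.
Unset Strict Implicit.
Unset Printing Implicit Defensive.
Import Order.TTheory GRing.Theory Num.Theory.
Import numFieldNormedType.Exports.
Local Open Scope classical_set_scope.
Local Open Scope ring_scope.

(** In a fibred chart write FL(t, q, v) = (t, q, p) with p = dL/dv, and let H be
    the local function of the Hamiltonian section, so that v.p - L = H o FL.
    Differentiating this identity, the Hessian terms group into the Jacobian
    matrix of FL: the covector

      (- dL/d(t, q), v) - dH o FL

    on the dual bundle ([defect]) vanishes on the image of the tangent map of FL
    ([defect_leg]).  That image is also annihilated by the differentials of the
    constraints; these are independent and as many as the corank of FL, so they
    span the annihilator ([annihilator_span]) and

      v^i = dH/dp_i + lambda^I dphi_I/dp_i,
      - dL/dq^i = dH/dq^i + lambda^I dphi_I/dq^i,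

    both along FL ([defect_split]).  Inserted in K.G, this gives
    K.G = {G, h_star} + lambda^I {G, phi_I} ([evolution_multiplier]).

    For G = phi_alpha the first term vanishes, the multipliers of h_0 being
    fixed, and so do the brackets with the first class constraints.  What remains,
    chi_alpha = {phi_alpha, phi_beta} lambda^beta, is solved by the inverse
    matrix M; the other multipliers are the functions nu^a.

    The dphi_I/dp are already independent, for a combination of the dphi_I
    without p-component annihilates the image of the tangent map of FL only if
    it is zero ([dphi_vdphi_free]).  Hence the lambda^I are determined by the
    first equation alone, through the inverse of a Gram matrix, and are
    smooth.  That equation only involves the fibre over a point of E, where a
    change of chart acts by an affine map on velocities and a linear one on
    momenta; so the lambda^I do not depend on the chart
    ([chart_multiplier_at]) and are smooth functions on the jet bundle.

    They are not projectable.  Differentiating the first equation along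
    a vector u tangent to the fibres of FL leaves
    u^i = (u.lambda^I) dphi_I/dp_i ([leg_ker_multiplier]).  The kernel of the
    tangent map has as many dimensions as there are constraints, so it contains
    u_J = (dphi_J/dp_i) d/dv^i, and u_J.lambda^I = delta^I_J; but u_J kills every
    projectable function ([multiplier_not_basic]).

    Finally, the q-components of i_Gamma Omega_L = 0 say that Gamma p = dL/dq
    ([theta_force]), so that K.phi = Gamma (phi o FL) = 0 for a primary
    constraint phi ([evolution_lag_primary]). *)

(** * Differential calculus in coordinates *)

Section Calculus.
Context {R : realType}.

Lemma near_eq_differentiable (V W : normedModType R) (f g : V -> W) x :
  (\near x, f x = g x) -> differentiable f x -> differentiable g x.
Proof.
move=> fg dfx; have gfx : f x = g x by exact: nbhs_singleton fg.
have [dfC /eqaddoP df] := iffLR (diff_locallyP _ _) dfx.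
have dg : g \o shift x = cst (g x) + 'd f x +o_ (0 : V) id.
  apply/eqaddoP => eps eps0; have := df eps eps0.
  have fg0 : \forall h \near (0 : V), f (h + x) = g (h + x).
    have : (fun h => h + x) @ (0 : V) --> x.
      by rewrite -[X in _ --> X]add0r; exact: (cvgD cvg_id (cvg_cst x)).
    by move=> /(_ _ fg).
  apply: filterS2 fg0 => h fgh.
  by rewrite /= !fctE /cst /= fgh gfx.
apply/diff_locallyP; rewrite (@diff_unique _ _ _ g ('d f x)) //.
Qed.

(** The two difference quotients are equal, hence so are their limits. *)
Lemma derive_comp_affine (U V W : normedModType R) (l F : U -> V) (f : V -> W)
    x v : (forall h : R, F (h *: v + x) = h *: l v + F x) ->
  'D_v (f \o F) x = 'D_(l v) f (F x).
Proof.
move=> lF; rewrite /derive.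
set P := fun h : R => h^-1 *: _; set Q := fun h : R => h^-1 *: _.
by rewrite (_ : P = Q) //; apply/funext => h; rewrite /P /Q /= lF.
Qed.

(** Gradients are rows, so that they compose with the row-vector convention
    of the Jacobian matrix by multiplication with its transpose. *)
Definition grad N (f : 'rV[R]_N -> R) x : 'rV[R]_N := \row_i partial i f x.

Lemma near_eq_partial N i (f g : 'rV[R]_N -> R) x :
  (\near x, f x = g x) -> partial i f x = partial i g x.
Proof. exact: near_eq_derive. Qed.

Lemma near_eq_grad N (f g : 'rV[R]_N -> R) x :
  (\near x, f x = g x) -> grad f x = grad g x.
Proof. by move=> fg; apply/rowP => i; rewrite !mxE; exact: near_eq_partial. Qed.

Lemma derive_grad N (f : 'rV[R]_N -> R) x v :
  differentiable f x -> 'D_v f x = (v *m (grad f x)^T) 0 0.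
Proof.
move=> df; rewrite deriveE // [in LHS](row_sum_delta v) linear_sum mxE.
apply: eq_bigr => i _; rewrite linearZ /= !mxE /partial deriveE //.
Qed.

Lemma differentiable_rV N M (F : 'rV[R]_N -> 'rV[R]_M) x :
  (forall j, differentiable (fun y => F y 0 j) x) -> differentiable F x.
Proof.
move=> dF.
have -> : F = \sum_j (fun y => F y 0 j *: delta_mx 0 j).
  by apply/funext => y; rewrite fct_sumE -row_sum_delta.
by apply: differentiable_sum => j; exact: differentiableZl.
Qed.

Lemma differentiable_component N M (F : 'rV[R]_N -> 'rV[R]_M) x j :
  differentiable F x -> differentiable (fun y => F y 0 j) x.
Proof.
move=> dF; rewrite (_ : (fun y => _) = (fun y : 'rV[R]_M => y 0 j : R) \o F) //.
exact/differentiable_comp/differentiable_coord.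
Qed.

Lemma jacobianE N M (F : 'rV[R]_N -> 'rV[R]_M) x : differentiable F x ->
  'J F x = \matrix_(i, j) partial i (fun y => F y 0 j) x.
Proof.
move=> dF; apply/matrixP => i j; rewrite [RHS]mxE /partial [LHS]mxE.
have dj := @differentiable_coord R 1 M (F x) 0 j.
have -> : (fun y => F y 0 j) = (fun y : 'rV[R]_M => y 0 j : R) \o F by [].
rewrite deriveE; last exact: differentiable_comp.
rewrite [in RHS]diff_comp //=.
have @f : {linear 'rV[R]_M -> R}.
  by exists (fun y : 'rV[R]_M => y 0 j); do 2![eexists]; do ?[constructor];
     rewrite ?mxE// => ? *; rewrite ?mxE//; move=> ?; rewrite !mxE.
rewrite (_ : (fun y : 'rV[R]_M => y 0 j) = f) // diff_lin //.
exact/coord_continuous.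
Qed.

Lemma near_eq_jacobian N M (F G : 'rV[R]_N -> 'rV[R]_M) x :
  (\near x, F x = G x) -> differentiable F x -> 'J F x = 'J G x.
Proof.
move=> FG dF; rewrite (jacobianE dF) (jacobianE (near_eq_differentiable FG dF)).
apply/matrixP => i j; rewrite !mxE; apply: near_eq_partial.
by apply: filterS FG => y ->.
Qed.

Lemma jacobian_comp N M P (F : 'rV[R]_N -> 'rV[R]_M) (G : 'rV[R]_M -> 'rV[R]_P)
    x : differentiable F x -> differentiable G (F x) ->
  'J (G \o F) x = 'J F x *m 'J G (F x).
Proof.
move=> dF dG; have dGF := differentiable_comp dF dG.
apply/row_matrixP => i; rewrite row_mul 2!rowE.
rewrite -(deriveEjacobian _ dGF) -(deriveEjacobian _ dF).
rewrite -(deriveEjacobian _ dG) (deriveE _ dGF) (deriveE _ dF) (deriveE _ dG).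
by rewrite diff_comp.
Qed.

Lemma grad_comp N M (F : 'rV[R]_N -> 'rV[R]_M) (f : 'rV[R]_M -> R) x :
  differentiable F x -> differentiable f (F x) ->
  grad (f \o F) x = grad f (F x) *m ('J F x)^T.
Proof.
move=> dF df; have dfF := differentiable_comp dF df.
apply/rowP => i; rewrite [LHS]mxE /partial.
rewrite (deriveE _ dfF) diff_comp //= -(deriveE _ df) -(deriveE _ dF).
rewrite derive_grad // deriveEjacobian // -rowE.
by rewrite !mxE; apply: eq_bigr => j _; rewrite !mxE mulrC.
Qed.

Lemma partial_coord N (k j : 'I_N) (x : 'rV[R]_N) :
  partial k (fun y => y 0 j) x = (k == j)%:R.
Proof.
rewrite /partial (_ : (fun y => _) = id \o (fun y : 'rV[R]_N => y 0 j : R)) //.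
rewrite (@derive_comp_affine _ _ _ (fun y : 'rV[R]_N => y 0 j)).
  by rewrite derive_id mxE eqxx eq_sym.
by move=> h; rewrite !mxE.
Qed.

End Calculus.

(** * Smooth functions *)

Section SmoothFunctions.
Context {R : realType}.
Implicit Types N M k : nat.

Lemma open_nbhs_near (T : topologicalType) (U : set T) (P : T -> Prop) x :
  open U -> U x -> (forall y, U y -> P y) -> \near x, P x.
Proof.
move=> oU Ux UP; have := open_nbhs_nbhs (conj oU Ux).
exact: filterS.
Qed.

Lemma smooth_differentiable N (U : set 'rV[R]_N) f x :
  smooth_on U f -> U x -> differentiable f x.
Proof. by move=> /(_ 1%N)[df _] /df. Qed.

Lemma smooth_map_differentiable N M (U : set 'rV[R]_N)
    (F : 'rV[R]_N -> 'rV[R]_M) x :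
  smooth_map_on U F -> U x -> differentiable F x.
Proof.
by move=> sF Ux; apply: differentiable_rV => j; exact: smooth_differentiable Ux.
Qed.

Lemma smooth_partial N (U : set 'rV[R]_N) f i :
  smooth_on U f -> smooth_on U (partial i f).
Proof. by move=> sf k; have [_ /(_ i)] := sf k.+1. Qed.

(** The product and inverse rules need it: the derivative of a product contains
    the factors themselves. *)
Lemma Ck_lower k N (U : set 'rV[R]_N) f : Ck_on k.+1 U f -> Ck_on k U f.
Proof.
elim: k f => [|k IHk] f [df pf]; last by split=> // i; exact: IHk.
by move=> x /df; exact: differentiable_continuous.
Qed.

Section Rules.
Variables (N : nat) (U : set 'rV[R]_N).
Hypothesis oU : open U.

Lemma Ck_congr k f g : (forall x, U x -> f x = g x) ->
  Ck_on k U f -> Ck_on k U g.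
Proof.
have near_fg f' g' x : (forall x, U x -> f' x = g' x) -> U x ->
    \near x, f' x = g' x by move=> fg Ux; exact: open_nbhs_near fg.
elim: k f g => [|k IHk] f g fg /=.
  move=> Cf x Ux; rewrite /prop_for /continuous_at -fg //.
  apply: cvg_trans (Cf x Ux).
  exact: near_eq_cvg (near_fg _ _ _ _ fg Ux).
move=> [df pf]; split=> [x Ux|i].
  exact: near_eq_differentiable (near_fg _ _ _ _ fg Ux) (df x Ux).
by apply: (IHk _ _ _ (pf i)) => x Ux; apply/near_eq_partial/near_fg.
Qed.

Lemma smooth_congr f g : (forall x, U x -> f x = g x) ->
  smooth_on U f -> smooth_on U g.
Proof. by move=> fg sf k; exact: Ck_congr fg (sf k). Qed.

Lemma smooth_cst a : smooth_on U (fun=> a).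
Proof.
move=> k; elim: k a => [|k IHk] a /=; first by move=> x _; exact: cst_continuous.
split=> [x _|i]; first exact: differentiable_cst.
by apply: Ck_congr (IHk 0) => x Ux; rewrite /partial /= derive_cst.
Qed.

Lemma smooth_coord j : smooth_on U (fun x => x 0 j).
Proof.
move=> k; apply: Ck_lower; split=> [x _|i]; first exact: differentiable_coord.
apply: Ck_congr (smooth_cst (i == j)%:R k) => x Ux.
by rewrite partial_coord.
Qed.

Lemma CkD k f g : Ck_on k U f -> Ck_on k U g ->
  Ck_on k U (fun x => f x + g x).
Proof.
elim: k f g => [|k IHk] f g /=.
  by move=> Cf Cg x Ux; exact: (cvgD (Cf x Ux) (Cg x Ux)).
move=> [df pf] [dg pg]; split=> [x Ux|i].
  exact: (differentiableD (df x Ux) (dg x Ux)).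
apply: Ck_congr (IHk _ _ (pf i) (pg i)) => x Ux.
rewrite /partial (_ : (fun x => _) = f + g) // deriveD //.
- exact/diff_derivable/df.
- exact/diff_derivable/dg.
Qed.

Lemma CkM k f g : Ck_on k U f -> Ck_on k U g ->
  Ck_on k U (fun x => f x * g x).
Proof.
elim: k f g => [|k IHk] f g.
  by move=> Cf Cg x Ux; exact: (cvgM (Cf x Ux) (Cg x Ux)).
move=> Cf Cg; have [df pf] := Cf; have [dg pg] := Cg.
split=> [x Ux|i]; first exact: (differentiableM (df x Ux) (dg x Ux)).
apply: Ck_congr (CkD (IHk _ _ (Ck_lower Cf) (pg i))
                     (IHk _ _ (Ck_lower Cg) (pf i))) => x Ux.
rewrite /partial (_ : (fun x => _) = f * g) // deriveM //.
- exact/diff_derivable/df.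
- exact/diff_derivable/dg.
Qed.

Lemma CkV k (f : 'rV[R]_N -> R) : (forall x, U x -> f x != 0) -> Ck_on k U f ->
  Ck_on k U (fun x => (f x)^-1).
Proof.
move=> f0; elim: k => [|k IHk].
  by move=> Cf x Ux; exact: (cvgV (f0 x Ux) (Cf x Ux)).
move=> Cf; have [df pf] := Cf.
split=> [x Ux|i]; first exact: (differentiableV (df x Ux) (f0 x Ux)).
have CkVf := IHk (Ck_lower Cf).
apply: Ck_congr (CkM (CkM (smooth_cst (-1) k) (CkM CkVf CkVf)) (pf i)) => x Ux.
rewrite /partial deriveV ?f0 //; last first.
  exact/diff_derivable/df.
by rewrite /GRing.scale /= mulN1r -invfM expr2.
Qed.

Lemma smoothD f g : smooth_on U f -> smooth_on U g ->
  smooth_on U (fun x => f x + g x).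
Proof. by move=> sf sg k; exact: CkD. Qed.

Lemma smoothM f g : smooth_on U f -> smooth_on U g ->
  smooth_on U (fun x => f x * g x).
Proof. by move=> sf sg k; exact: CkM. Qed.

Lemma smoothV (f : 'rV[R]_N -> R) : (forall x, U x -> f x != 0) -> smooth_on U f ->
  smooth_on U (fun x => (f x)^-1).
Proof. by move=> f0 sf k; exact: CkV. Qed.

Lemma smoothN f : smooth_on U f -> smooth_on U (fun x => - f x).
Proof.
move=> sf; apply: smooth_congr (smoothM (smooth_cst (-1)) sf) => x _.
by rewrite mulN1r.
Qed.

Lemma Ck_sum k I (r : seq I) (f : I -> 'rV[R]_N -> R) :
  (forall i, Ck_on k U (f i)) -> Ck_on k U (fun x => \sum_(i <- r) f i x).
Proof.
move=> sf; elim: r => [|i r IHr].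
  by apply: Ck_congr (smooth_cst 0 k) => x _; rewrite big_nil.
by apply: Ck_congr (CkD (sf i) IHr) => x _; rewrite big_cons.
Qed.

Lemma smooth_sum I (r : seq I) (f : I -> 'rV[R]_N -> R) :
  (forall i, smooth_on U (f i)) ->
  smooth_on U (fun x => \sum_(i <- r) f i x).
Proof. by move=> sf k; apply: Ck_sum => i; exact: sf. Qed.

Lemma smooth_prod I (r : seq I) (f : I -> 'rV[R]_N -> R) :
  (forall i, smooth_on U (f i)) ->
  smooth_on U (fun x => \prod_(i <- r) f i x).
Proof.
move=> sf; elim: r => [|i r IHr].
  by apply: smooth_congr (smooth_cst 1) => x _; rewrite big_nil.
by apply: smooth_congr (smoothM (sf i) IHr) => x _; rewrite big_cons.
Qed.

End Rules.

(** Only f is taken at a finite order in the induction: in the chain rule its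
    order drops, while F, smooth, is used at every order. *)
Lemma smooth_comp N M (U : set 'rV[R]_N) (V : set 'rV[R]_M) F f :
  open U -> (forall x, U x -> V (F x)) ->
  smooth_map_on U F -> smooth_on V f -> smooth_on U (f \o F).
Proof.
move=> oU UV sF sf k; have {sf} := sf k.
elim: k f => [|k IHk] f.
  move=> Cf x Ux; have dF := smooth_map_differentiable sF Ux.
  exact: (continuous_comp (differentiable_continuous dF) (Cf _ (UV _ Ux))).
move=> [df pf]; have dF x : U x -> differentiable F x.
  exact: smooth_map_differentiable.
split=> [x Ux|i].
  exact: (differentiable_comp (dF x Ux) (df _ (UV _ Ux))).
have Cki : Ck_on k U (fun x => \sum_j partial i (fun y => F y 0 j) x
                                     * (partial j f \o F) x).
  apply: Ck_sum => // j; apply: CkM => //; last exact: IHk (pf j).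
  exact: smooth_partial.
apply: Ck_congr Cki => // x Ux.
have := grad_comp (dF x Ux) (df _ (UV _ Ux)) => /rowP/(_ i).
rewrite jacobianE; last exact: dF.
rewrite !mxE => ->; apply: eq_bigr => j _; by rewrite !mxE mulrC.
Qed.

Section Matrices.
Variables (N : nat) (U : set 'rV[R]_N).
Hypothesis oU : open U.

Definition smooth_mx p q (A : 'rV[R]_N -> 'M[R]_(p, q)) :=
  forall i j, smooth_on U (fun x => A x i j).

Lemma smooth_mxN p q (A : 'rV[R]_N -> 'M[R]_(p, q)) :
  smooth_mx A -> smooth_mx (fun x => - A x).
Proof.
move=> sA i j; apply: smooth_congr (smoothN oU (sA i j)) => // x _.
by rewrite mxE.
Qed.

Lemma smooth_mxD p q (A B : 'rV[R]_N -> 'M[R]_(p, q)) :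
  smooth_mx A -> smooth_mx B -> smooth_mx (fun x => A x + B x).
Proof.
move=> sA sB i j; apply: smooth_congr (smoothD oU (sA i j) (sB i j)) => // x _.
by rewrite mxE.
Qed.

Lemma smooth_mulmx p q r (A : 'rV[R]_N -> 'M[R]_(p, q))
    (B : 'rV[R]_N -> 'M[R]_(q, r)) :
  smooth_mx A -> smooth_mx B -> smooth_mx (fun x => A x *m B x).
Proof.
move=> sA sB i j.
apply: (smooth_congr oU (f := fun x => \sum_k A x i k * B x k j)).
  by move=> x _; rewrite mxE.
by apply: smooth_sum => // k; exact: smoothM.
Qed.

Lemma smooth_trmx p q (A : 'rV[R]_N -> 'M[R]_(p, q)) :
  smooth_mx A -> smooth_mx (fun x => (A x)^T).
Proof.
by move=> sA i j; apply: smooth_congr (sA j i) => // x _; rewrite mxE.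
Qed.

Lemma smooth_det p (A : 'rV[R]_N -> 'M[R]_p) :
  smooth_mx A -> smooth_on U (fun x => \det (A x)).
Proof.
move=> sA; apply: smooth_sum => // s; apply: smoothM => //.
  exact: smooth_cst.
by apply: smooth_prod => // i; exact: sA.
Qed.

(** By Cramer's rule the entries are polynomials in those of A divided by the
    determinant. *)
Lemma smooth_invmx p (A : 'rV[R]_N -> 'M[R]_p) :
  (forall x, U x -> A x \in unitmx) ->
  smooth_mx A -> smooth_mx (fun x => invmx (A x)).
Proof.
move=> uA sA i j.
apply: (smooth_congr oU
  (f := fun x => (\det (A x))^-1 * ((-1) ^+ (j + i) *
                   \det (row' j (col' i (A x)))))).
  by move=> x Ux; rewrite /invmx uA // !mxE.
apply: smoothM => //; last apply: smoothM => //.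
- apply: smoothV => //; last exact: smooth_det.
  by move=> x /uA; rewrite unitmxE unitfE.
- exact: smooth_cst.
- apply: smooth_det => k l; apply: smooth_congr (sA (lift j k) (lift i l)) => //.
  by move=> x _; rewrite !mxE.
Qed.

End Matrices.

End SmoothFunctions.

(** * Coefficients on linearly independent rows *)

Section Pseudoinverse.
Context {R : realFieldType}.

(** If c D D^T = 0 then c D has norm zero. *)
Lemma gram_unit m n (D : 'M[R]_(m, n)) : row_free D -> D *m D^T \in unitmx.
Proof.
move=> fD; rewrite -row_free_unit -kermx_eq0; apply/eqP/row_matrixP => i.
rewrite row0; set c := row i _.
have cDD : c *m (D *m D^T) = 0 by rewrite /c -row_mul mulmx_ker row0.
suff : c *m D = 0.
  by move/eqP; rewrite mulmx_free_eq0 // => /eqP.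
have : (c *m D) *m (c *m D)^T = 0.
  by rewrite trmx_mul mulmxA -(mulmxA c) cDD mul0mx.
move: (c *m D) => u /matrixP/(_ 0 0); rewrite !mxE => /eqP.
rewrite psumr_eq0 => [/allP sq0|k _]; last by rewrite !mxE sqr_ge0.
apply/rowP => k; have := sq0 k (mem_index_enum k).
by rewrite /= !mxE mulf_eq0 orbb => /eqP.
Qed.

(** A closed formula for the coefficients of w on the rows of D: it depends
    smoothly on both. *)
Definition row_coefs m n (D : 'M[R]_(m, n)) (w : 'rV[R]_n) : 'rV[R]_m :=
  w *m D^T *m invmx (D *m D^T).

Lemma row_coefsK m n (D : 'M[R]_(m, n)) (c : 'rV[R]_m) :
  row_free D -> row_coefs D (c *m D) = c.
Proof. by move=> fD; rewrite /row_coefs -(mulmxA c) mulmxK ?gram_unit. Qed.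

End Pseudoinverse.

(** * A constrained Lagrangian in one chart *)

(** Coordinates are split into p base coordinates, the (t, q), and n fibre
    coordinates, the velocities on the Lagrangian side and the momenta on the
    Hamiltonian one. *)
Section LocalTheory.
Context {R : realType} {p n m : nat}.
Local Notation N := (p + n)%N.

Definition bgrad (f : 'rV[R]_N -> R) z : 'rV[R]_p :=
  \row_i partial (lshift n i) f z.

Definition vgrad (f : 'rV[R]_N -> R) z : 'rV[R]_n :=
  \row_i partial (rshift p i) f z.

Lemma grad_split f z : grad f z = row_mx (bgrad f z) (vgrad f z).
Proof.
apply/rowP => k; rewrite mxE; case: (split_ordP k) => j ->;
by rewrite ?row_mxEl ?row_mxEr mxE.
Qed.

Definition vjac q (F : 'rV[R]_N -> 'rV[R]_q) z : 'M[R]_(n, q) :=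
  \matrix_(i, j) partial (rshift p i) (fun y => F y 0 j) z.

Lemma partial_rsubmx k i (z : 'rV[R]_N) :
  partial k (fun y => rsubmx y 0 i) z = (k == rshift p i)%:R.
Proof.
rewrite (_ : (fun y => _) = fun y : 'rV[R]_N => y 0 (rshift p i)).
  by rewrite partial_coord.
by apply/funext => y; rewrite mxE.
Qed.

Lemma delta_rshift (i : 'I_n) :
  delta_mx 0 (rshift p i) = row_mx 0 (delta_mx 0 i) :> 'rV[R]_N.
Proof.
apply/rowP => k; case: (split_ordP k) => j ->.
  by rewrite row_mxEl !mxE eq_lrshift andbF.
by rewrite row_mxEr !mxE (inj_eq (@rshift_inj _ _)).
Qed.

(** Used for changes of fibred charts: over a fixed point they are affine in the
    velocities and linear in the momenta, so derivatives along the fibres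
    transform without any derivative of the transition matrices. *)
Lemma vgrad_affine (f g : 'rV[R]_N -> R) (x y : 'rV[R]_p) (a v : 'rV[R]_n) A :
  (forall v, f (row_mx x v) = g (row_mx y (a + v *m A))) ->
  differentiable g (row_mx y (a + v *m A)) ->
  vgrad f (row_mx x v) = vgrad g (row_mx y (a + v *m A)) *m A^T.
Proof.
move=> fg dg; apply/rowP => i; rewrite [LHS]mxE.
pose F u : 'rV[R]_N := row_mx x u; pose G u : 'rV[R]_N := row_mx y (a + u *m A).
have -> : partial (rshift p i) f (row_mx x v) = 'D_(delta_mx 0 i) (f \o F) v.
  rewrite (@derive_comp_affine _ _ _ _ (row_mx 0)).
    by rewrite /partial delta_rshift.
  by move=> h; rewrite /F scale_row_mx add_row_mx scaler0 add0r.
have -> : f \o F = g \o G by apply/funext => u; exact: fg.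
rewrite (@derive_comp_affine _ _ _ _ (fun u => row_mx 0 (u *m A))); last first.
  move=> h; rewrite /G scale_row_mx add_row_mx scaler0 add0r.
  by rewrite mulmxDl scalemxAl addrCA.
rewrite derive_grad // grad_split tr_row_mx mul_row_col mul0mx add0r.
rewrite -rowE !mxE; apply: eq_bigr => k _; by rewrite !mxE mulrC.
Qed.

Lemma pairingE (a : 'rV[R]_n) : (fun w : 'rV[R]_N => (rsubmx w *m a^T) 0 0) =
  \sum_k (a 0 k \*: (fun w : 'rV[R]_N => w 0 (rshift p k) : R)).
Proof.
apply/funext => y; rewrite fct_sumE mxE; apply: eq_bigr => k _.
by rewrite !mxE mulrC.
Qed.

Lemma pairing_diff (a : 'rV[R]_n) z :
  differentiable (fun w : 'rV[R]_N => (rsubmx w *m a^T) 0 0) z.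
Proof.
rewrite pairingE; apply: differentiable_sum => k.
exact/differentiableZ/differentiable_coord.
Qed.

Lemma vgrad_sub_pairing (f : 'rV[R]_N -> R) (a : 'rV[R]_n) z :
  differentiable f z ->
  vgrad (fun w => f w - (rsubmx w *m a^T) 0 0) z = vgrad f z - a.
Proof.
move=> df; apply/rowP => i; rewrite !mxE /partial.
rewrite (_ : (fun y => _) = f - (fun w => (rsubmx w *m a^T) 0 0)) //.
rewrite deriveB; last 2 first.
- exact: diff_derivable.
- exact/diff_derivable/pairing_diff.
have dc k : derivable (fun w : 'rV[R]_N => w 0 (rshift p k) : R) z
    (delta_mx 0 (rshift p i)) by exact/diff_derivable/differentiable_coord.
rewrite pairingE derive_sum; last by move=> k; exact: derivableZ.
congr (_ - _); rewrite (bigD1 i) //= big1 => [|k ki].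
  by rewrite deriveZ // -/(partial _ _ _) partial_coord eqxx addr0 [LHS]mulr1.
rewrite deriveZ // -/(partial _ _ _) partial_coord.
by rewrite (inj_eq (@rshift_inj _ _)) eq_sym (negbTE ki) scaler0.
Qed.

Lemma vjac_affine q (F G : 'rV[R]_N -> 'rV[R]_q) (C : 'M[R]_q)
    (x y : 'rV[R]_p) (a v : 'rV[R]_n) A :
  (forall v, F (row_mx x v) = G (row_mx y (a + v *m A)) *m C) ->
  differentiable G (row_mx y (a + v *m A)) ->
  vjac F (row_mx x v) = A *m vjac G (row_mx y (a + v *m A)) *m C.
Proof.
move=> FG dG; set z := row_mx y _.
have dGk k : differentiable (fun w => G w 0 k) z.
  exact: differentiable_component.
apply/matrixP => i j.
pose g := \sum_k (C k j *: (fun w => G w 0 k)).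
have dg : differentiable g z.
  by apply: differentiable_sum => k; exact: differentiableZ.
have -> : vjac F (row_mx x v) i j = vgrad (fun w => F w 0 j) (row_mx x v) 0 i.
  by rewrite !mxE.
rewrite (@vgrad_affine _ g x y a v A) //; last first.
  move=> u; rewrite FG mxE /g fct_sumE; apply: eq_bigr => k _.
  by rewrite fctE /= mulrC.
have -> : vgrad g z = \row_l (vjac G z *m C) l j.
  apply/rowP => l; rewrite !mxE /partial derive_sum; last first.
    by move=> k; apply/diff_derivable/differentiableZ.
  apply: eq_bigr => k _; rewrite deriveZ; last exact/diff_derivable.
  by rewrite mxE mulrC.
rewrite -mulmxA !mxE; apply: eq_bigr => l _; by rewrite !mxE mulrC.
Qed.

Variables (P : set 'rV[R]_p) (L H : 'rV[R]_N -> R) (phi : 'I_m -> 'rV[R]_N -> R).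
Let U : set 'rV[R]_N := [set z | P (lsubmx z)].
Hypothesis oP : open P.
Hypothesis sL : smooth_on U L.
Hypothesis sH : smooth_on U H.
Hypothesis sphi : forall I, smooth_on U (phi I).

(** The Legendre map in coordinates: vgrad L z is the row of momenta. *)
Definition leg z : 'rV[R]_N := row_mx (lsubmx z) (vgrad L z).

Lemma lsubmx_open : open U.
Proof.
apply: open_comp => // z _; exact: continuous_lsubmx.
Qed.
Let oU := lsubmx_open.

Lemma legU z : U z -> U (leg z).
Proof. by rewrite /U /= /leg row_mxKl. Qed.

Lemma vgrad_smooth f : smooth_on U f -> smooth_map_on U (vgrad f).
Proof.
move=> sf j; apply: smooth_congr (smooth_partial (rshift p j) sf) => //.
by move=> x _; rewrite mxE.
Qed.

Lemma leg_smooth : smooth_map_on U leg.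
Proof.
move=> k; case: (split_ordP k) => j ->.
  apply: smooth_congr (smooth_coord oU (lshift n j)) => // x _.
  by rewrite row_mxEl mxE.
by apply: smooth_congr (vgrad_smooth sL j) => // x _; rewrite row_mxEr.
Qed.

Lemma leg_diff z : U z -> differentiable leg z.
Proof. exact: smooth_map_differentiable leg_smooth. Qed.

Lemma jacobian_leg z : U z ->
  'J leg z = row_mx (col_mx 1%:M 0) ('J (vgrad L) z).
Proof.
move=> Uz.
have dv : differentiable (vgrad L) z.
  exact: smooth_map_differentiable (vgrad_smooth sL) Uz.
rewrite !jacobianE //; last exact: leg_diff.
apply/matrixP => i k; rewrite mxE; case: (split_ordP k) => j ->.
  rewrite row_mxEl (_ : (fun y => _) =
    (fun y : 'rV[R]_N => y 0 (lshift n j))); last first.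
    by apply/funext => y; rewrite row_mxEl mxE.
  rewrite partial_coord; case: (split_ordP i) => l ->.
    by rewrite col_mxEu mxE (inj_eq (@lshift_inj _ _)).
  by rewrite col_mxEd mxE eq_rlshift.
rewrite row_mxEr mxE (_ : (fun y => _) = fun y => vgrad L y 0 j) //.
by apply/funext => y; rewrite row_mxEr.
Qed.

Lemma energy_diff z : U z ->
  differentiable (fun y => \sum_i rsubmx y 0 i * vgrad L y 0 i - L y) z.
Proof.
move=> Uz; rewrite (_ : (fun y => _) =
  (\sum_i ((fun y : 'rV[R]_N => rsubmx y 0 i) * (fun y => vgrad L y 0 i))) - L).
  apply: differentiableB; last exact: smooth_differentiable sL Uz.
  apply: differentiable_sum => i; apply: differentiableM.
    exact/differentiable_component/differentiable_rsubmx.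
  by apply: smooth_differentiable (vgrad_smooth sL i) Uz.
by apply/funext => y; rewrite !fctE fct_sumE.
Qed.

(** The terms in dL/dv cancel, which leaves second derivatives of L and the
    explicit forces dL/d(t, q). *)
Lemma grad_energy z : U z ->
  grad (fun y => \sum_i rsubmx y 0 i * vgrad L y 0 i - L y) z =
  row_mx (- bgrad L z) 0 + rsubmx z *m ('J (vgrad L) z)^T.
Proof.
move=> Uz; symmetry.
have dv : differentiable (vgrad L) z.
  exact: smooth_map_differentiable (vgrad_smooth sL) Uz.
have dL := smooth_differentiable sL Uz.
have dvi i : differentiable (fun y => vgrad L y 0 i) z.
  exact: differentiable_component.
have dci i : differentiable (fun y : 'rV[R]_N => rsubmx y 0 i) z.
  exact/differentiable_component/differentiable_rsubmx.
have E : (fun y => \sum_i rsubmx y 0 i * vgrad L y 0 i - L y) =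
    (\sum_i ((fun y : 'rV[R]_N => rsubmx y 0 i) * (fun y => vgrad L y 0 i))) - L.
  by apply/funext => y; rewrite !fctE fct_sumE.
rewrite E; apply/rowP => k; rewrite [RHS]mxE /partial.
rewrite deriveB; last 2 first.
- apply: derivable_sum => i; apply/diff_derivable; exact: differentiableM.
- exact/diff_derivable.
rewrite derive_sum; last by move=> i; apply/diff_derivable; exact: differentiableM.
rewrite -[X in _ - X]/(partial k L z).
have -> : \sum_(i < n) 'D_(delta_mx 0 k)
     ((fun y : 'rV[R]_N => rsubmx y 0 i) * (fun y => vgrad L y 0 i)) z =
   (rsubmx z *m ('J (vgrad L) z)^T) 0 k + row_mx 0 (vgrad L z) 0 k.
  have -> : row_mx 0 (vgrad L z) 0 k =
      \sum_i vgrad L z 0 i * (k == rshift p i)%:R.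
    case: (split_ordP k) => j ->.
      by rewrite row_mxEl mxE big1 // => i _; rewrite eq_lrshift mulr0.
    rewrite row_mxEr (bigD1 j) //= eqxx mulr1 big1 ?addr0 // => i ij.
    by rewrite (inj_eq (@rshift_inj _ _)) eq_sym (negbTE ij) mulr0.
  rewrite mxE -big_split /=; apply: eq_bigr => i _.
  rewrite deriveM; last 2 first.
  - exact/diff_derivable.
  - exact/diff_derivable.
  rewrite jacobianE // !mxE; congr (_ + _ * _).
  exact: partial_rsubmx.
rewrite [LHS]mxE addrC -[RHS]addrA; congr (_ + _).
have -> : partial k L z = grad L z 0 k by rewrite mxE.
rewrite grad_split; case: (split_ordP k) => j ->.
  by rewrite !row_mxEl !mxE sub0r.
by rewrite !row_mxEr !mxE subrr.
Qed.

Lemma rank_jacobian_leg z : U z ->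
  \rank ('J leg z) = (p + \rank (vjac (vgrad L) z))%N.
Proof.
move=> Uz; have dv : differentiable (vgrad L) z.
  exact: smooth_map_differentiable (vgrad_smooth sL) Uz.
have vJ : dsubmx ('J (vgrad L) z) = vjac (vgrad L) z.
  by rewrite jacobianE //; apply/matrixP => i j; rewrite !mxE.
rewrite jacobian_leg // -[X in row_mx _ X]vsubmxK vJ -block_mxEh.
set K := usubmx _; set W := vjac _ _.
have -> : block_mx 1%:M K 0 W = block_mx 1%:M 0 0 W *m block_mx 1%:M K 0 1%:M.
  by rewrite mulmx_block !mul1mx !mul0mx !mulmx0 !mulmx1 !addr0 !add0r.
rewrite mxrankMfree ?rank_diag_block_mx ?mxrank1 // row_free_unit unitmxE.
by rewrite det_ublock !det1 mulr1 unitr1.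
Qed.

Hypothesis HL : forall z, U z ->
  H (leg z) = \sum_i rsubmx z 0 i * vgrad L z 0 i - L z.
Hypothesis phi0 : forall I z, U z -> phi I (leg z) = 0.

Definition dphi w : 'M[R]_(m, N) := \matrix_(I, k) partial k (phi I) w.
Definition vdphi w : 'M[R]_(m, n) := \matrix_(I, k) partial (rshift p k) (phi I) w.

Definition bdphi w : 'M[R]_(m, p) := \matrix_(I, k) partial (lshift n k) (phi I) w.

Lemma dphi_split w : dphi w = row_mx (bdphi w) (vdphi w).
Proof.
apply/matrixP => I k; rewrite mxE; case: (split_ordP k) => j ->;
by rewrite ?row_mxEl ?row_mxEr mxE.
Qed.

Lemma dphi_leg z : U z -> dphi (leg z) *m ('J leg z)^T = 0.
Proof.
move=> Uz; apply/row_matrixP => I; rewrite row_mul row0.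
have -> : row I (dphi (leg z)) = grad (phi I) (leg z).
  by apply/rowP => k; rewrite !mxE.
rewrite -grad_comp; last 2 first.
- exact: leg_diff.
- exact: smooth_differentiable (sphi I) (legU Uz).
rewrite (@near_eq_grad _ _ _ (fun=> 0)); last exact: open_nbhs_near oU Uz (phi0 I).
by apply/rowP => k; rewrite !mxE /partial derive_cst.
Qed.

(** A combination of the differentials without fibre component is its own
    pullback by the Legendre map, which preserves the base coordinates; but
    this pullback is zero. *)
Lemma dphi_vdphi_free z :
  U z -> row_free (dphi (leg z)) -> row_free (vdphi (leg z)).
Proof.
move=> Uz phi_free; rewrite -kermx_eq0; apply/eqP/row_matrixP => i; rewrite row0.
set c := row i _.
have cD : c *m vdphi (leg z) = 0 by rewrite /c -row_mul mulmx_ker row0.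
have E : c *m dphi (leg z) = row_mx (c *m bdphi (leg z)) 0.
  by rewrite dphi_split mul_mx_row cD.
have : c *m dphi (leg z) *m ('J leg z)^T = 0.
  by rewrite -mulmxA dphi_leg // mulmx0.
rewrite E jacobian_leg // tr_row_mx mul_row_col mul0mx addr0 tr_col_mx.
rewrite trmx1 trmx0 mul_mx_row mulmx1 mulmx0 -E => /eqP.
by rewrite mulmx_free_eq0 // => /eqP.
Qed.

Hypothesis vdphi_free : forall z, U z -> row_free (vdphi (leg z)).
Hypothesis hessian_rank : forall z, U z -> (\rank (vjac (vgrad L) z) + m = n)%N.

Lemma dphi_free z : U z -> row_free (dphi (leg z)).
Proof.
move=> Uz; rewrite -kermx_eq0; apply/eqP/row_matrixP => i; rewrite row0.
set c := row i _.
have : c *m dphi (leg z) = row_mx 0 0.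
  by rewrite /c -row_mul mulmx_ker row0 row_mx0.
rewrite dphi_split mul_mx_row => /eq_row_mx[_ /eqP].
by rewrite mulmx_free_eq0 ?vdphi_free // => /eqP.
Qed.

Lemma leg_rank z : U z -> (\rank ('J leg z) + m = N)%N.
Proof. by move=> Uz; rewrite rank_jacobian_leg // -addnA hessian_rank. Qed.

(** The rows of the differentials span the annihilator of the image of the
    Legendre map: they lie in it, and there are as many of them as its
    dimension. *)
Lemma annihilator_span z (w : 'rV[R]_N) : U z -> w *m ('J leg z)^T = 0 ->
  exists c, w = c *m dphi (leg z).
Proof.
move=> Uz wJ; suff : (w <= dphi (leg z))%MS by move/submxP.
have sub : (dphi (leg z) <= kermx ('J leg z)^T)%MS.
  by apply/sub_kermxP; exact: dphi_leg.
have /mxrank_leqif_eq[_] := sub.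
rewrite mxrank_ker mxrank_tr -{2}(leg_rank Uz) addKn.
rewrite (eqP (dphi_free Uz)) eqxx => /esym/eqmxP eqk.
by rewrite eqk; apply/sub_kermxP.
Qed.

(** The obstruction to Hamilton's equations with Hamiltonian H: the second block is
    the velocity minus dH/dp, the first one the force equation. *)
Definition defect z : 'rV[R]_N :=
  row_mx (- bgrad L z) (rsubmx z) - grad H (leg z).

Lemma defect_leg z : U z -> defect z *m ('J leg z)^T = 0.
Proof.
move=> Uz; rewrite mulmxBl -grad_comp; last 2 first.
- exact: leg_diff.
- exact: smooth_differentiable sH (legU Uz).
rewrite (near_eq_grad (open_nbhs_near oU Uz HL)) grad_energy //.
by rewrite jacobian_leg // tr_row_mx mul_row_col tr_col_mx trmx1 trmx0
           mul_mx_row mulmx1 mulmx0 subrr.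
Qed.

(** Only the fibre part of the defect enters, so that the behaviour under changes
    of charts can be read off from derivatives along the fibres. *)
Definition multiplier z : 'rV[R]_m :=
  row_coefs (vdphi (leg z)) (rsubmx z - vgrad H (leg z)).

Lemma multiplierP z c : U z ->
  rsubmx z - vgrad H (leg z) = c *m vdphi (leg z) -> c = multiplier z.
Proof. by move=> Uz E; rewrite /multiplier E row_coefsK ?vdphi_free. Qed.

Lemma defectE z : U z -> defect z = multiplier z *m dphi (leg z).
Proof.
move=> Uz; have [c Ec] := annihilator_span Uz (defect_leg Uz).
rewrite Ec -(@multiplierP z c) //.
move: Ec; rewrite dphi_split mul_mx_row /defect grad_split.
by rewrite opp_row_mx add_row_mx => /eq_row_mx[].
Qed.

Lemma defect_split z : U z ->
  - bgrad L z - bgrad H (leg z) = multiplier z *m bdphi (leg z) /\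
  rsubmx z - vgrad H (leg z) = multiplier z *m vdphi (leg z).
Proof.
move=> Uz; have := defectE Uz.
rewrite dphi_split mul_mx_row /defect grad_split opp_row_mx add_row_mx.
exact: eq_row_mx.
Qed.

Lemma dphi_smooth : smooth_mx U (fun z => dphi (leg z)).
Proof.
move=> I k.
apply: smooth_congr (smooth_comp oU legU leg_smooth
                       (smooth_partial k (sphi I))) => //.
by move=> x _; rewrite mxE.
Qed.

Lemma vdphi_smooth : smooth_mx U (fun z => vdphi (leg z)).
Proof.
move=> I k; apply: smooth_congr (dphi_smooth I (rshift p k)) => // x _.
by rewrite !mxE.
Qed.

Lemma multiplier_smooth I : smooth_on U (fun z => multiplier z 0 I).
Proof.
have sD := vdphi_smooth; have sDT := smooth_trmx oU sD.
apply: (smooth_mulmx oU (smooth_mulmx oU _ sDT) (smooth_invmx oU _ _)) => //.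
- apply: smooth_mxD => //.
    move=> i j; rewrite [i]ord1.
    apply: smooth_congr (smooth_coord oU (rshift p j)) => // x _.
    by rewrite mxE.
  apply: smooth_mxN => // i j; rewrite [i]ord1.
  apply: smooth_congr (smooth_comp oU legU leg_smooth
                         (smooth_partial (rshift p j) sH)) => //.
  by move=> x _; rewrite mxE.
- by move=> x Ux; apply: gram_unit; exact: vdphi_free.
- exact: smooth_mulmx.
Qed.

Lemma derive_leg_ker (f : 'rV[R]_N -> R) z (u : 'rV[R]_N) :
  U z -> differentiable f (leg z) -> u *m 'J leg z = 0 -> 'D_u (f \o leg) z = 0.
Proof.
move=> Uz df uJ; rewrite derive_grad; last exact/differentiable_comp/df/leg_diff.
rewrite grad_comp //; last exact: leg_diff.
by rewrite trmx_mul trmxK mulmxA uJ mul0mx mxE.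
Qed.

Lemma leg_ker_vertical z (u : 'rV[R]_N) : U z -> u *m 'J leg z = 0 ->
  u = row_mx 0 (rsubmx u).
Proof.
move=> Uz; rewrite jacobian_leg // mul_mx_row -[RHS](@row_mx0 _ 1 p n).
case/eq_row_mx; rewrite -{1}[u]hsubmxK mul_row_col mulmx1 mulmx0 addr0 => u0 _.
by rewrite -{1}[u]hsubmxK u0.
Qed.

(** Derivative along u of the equation
    velocity = dH/dp + multiplier . dphi/dp, where dH/dp and dphi/dp are taken
    along the Legendre map and so have derivative zero. *)
Lemma leg_ker_multiplier z (u : 'rV[R]_N) : U z -> u *m 'J leg z = 0 ->
  rsubmx u = (\row_I 'D_u (fun y => multiplier y 0 I) z) *m vdphi (leg z).
Proof.
move=> Uz uJ; have Ulz := legU Uz.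
have dH i : differentiable (partial (rshift p i) H) (leg z).
  exact: smooth_differentiable (smooth_partial _ sH) Ulz.
have dphiI I i : differentiable (partial (rshift p i) (phi I)) (leg z).
  exact: smooth_differentiable (smooth_partial _ (sphi I)) Ulz.
have dlam I : differentiable (fun y => multiplier y 0 I) z.
  exact: smooth_differentiable (multiplier_smooth I) Uz.
have dl := leg_diff Uz.
apply/rowP => i.
pose lhs (y : 'rV[R]_N) : R := y 0 (rshift p i).
pose rhs : 'rV[R]_N -> R := (partial (rshift p i) H \o leg) +
  \sum_I ((fun y => multiplier y 0 I) * (partial (rshift p i) (phi I) \o leg)).
(* The equation on velocities, component i. *)
have E : \near z, lhs z = rhs z.
  apply: (open_nbhs_near oU Uz) => y Uy.
  have [_] := defect_split Uy; rewrite /lhs /rhs !fctE fct_sumE /=.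
  under eq_bigr do rewrite fctE /=.
  move: (multiplier y) => c /rowP/(_ i).
  rewrite !mxE => /eqP; rewrite subr_eq => /eqP ->.
  by rewrite addrC; congr (_ + _); apply: eq_bigr => I _; rewrite !mxE.
have -> : rsubmx u 0 i = 'D_u lhs z.
  rewrite derive_grad; last exact: differentiable_coord.
  rewrite [LHS]mxE [u in LHS]row_sum_delta summxE mxE; apply: eq_bigr => k _.
  by rewrite !mxE partial_coord eqxx /= eq_sym.
rewrite (near_eq_derive _ E) deriveD; last 2 first.
- exact/diff_derivable/differentiable_comp.
- apply/derivable_sum => I; apply/diff_derivable/differentiableM => //.
  exact: differentiable_comp.
rewrite derive_leg_ker // add0r derive_sum; last first.
  move=> I; apply/diff_derivable/differentiableM => //.
  exact: differentiable_comp.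
rewrite mxE; apply: eq_bigr => I _; rewrite deriveM; last 2 first.
- exact/diff_derivable.
- exact/diff_derivable/differentiable_comp.
by rewrite derive_leg_ker // scaler0 add0r !mxE mulrC.
Qed.

(** By the previous lemma the kernel of the tangent map lies in the span of these
    vectors, which are no more than its dimension. *)
Lemma vdphi_leg_ker z I : U z ->
  row_mx 0 (row I (vdphi (leg z))) *m 'J leg z = 0.
Proof.
move=> Uz; set V : 'M[R]_(m, N) := row_mx 0 (vdphi (leg z)).
have kV : (kermx ('J leg z) <= V)%MS.
  apply/row_subP => i; set u := row i _.
  have uJ : u *m 'J leg z = 0 by rewrite /u -row_mul mulmx_ker row0.
  rewrite (leg_ker_vertical Uz uJ) (leg_ker_multiplier Uz uJ).
  set Du := \row_I _.
  by rewrite -[0](mulmx0 _ Du) -mul_mx_row submxMl.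
have Vk : (V <= kermx ('J leg z))%MS.
  rewrite -(geq_leqif (mxrank_leqif_sup kV)) mxrank_ker.
  have /(canRL (addKn _)) <- : (\rank ('J leg z) + m = N)%N by exact: leg_rank.
  exact: rank_leq_row.
have -> : row_mx 0 (row I (vdphi (leg z))) = row I V.
  by rewrite row_row_mx row0.
by apply/sub_kermxP; apply: submx_trans Vk; exact: row_sub.
Qed.

(** The I-th multiplier grows at unit speed along the I-th vector of the previous
    lemma, which is tangent to the fibres of the Legendre map. *)
Lemma multiplier_not_basic I (g : 'rV[R]_N -> R) z :
  U z -> differentiable g (leg z) -> ~ (\near z, multiplier z 0 I = g (leg z)).
Proof.
move=> Uz dg E; have uJ := vdphi_leg_ker I Uz.
have := leg_ker_multiplier Uz uJ; rewrite row_mxKr [LHS]rowE.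
move/(row_free_inj (vdphi_free Uz))/rowP/(_ I); rewrite !mxE !eqxx.
rewrite (near_eq_derive _ E) (derive_leg_ker Uz dg uJ) => /eqP.
by rewrite oner_eq0.
Qed.

End LocalTheory.

(** * Fibred charts *)

Local Notation finv := Defs.finv.

Section Charts.
Context {R : realType} {n : nat} {B : fibre_bundle R n}.
Implicit Types (c : fchart B) (e : B) (x : 'rV[R]_(1 + n)).

Lemma minvK (X : manifold R n) (c : mchart X) q :
  (mcoord c @` mdom c) q -> mdom c (minv c q) /\ mcoord c (minv c q) = q.
Proof. by move=> [y cy <-]; rewrite mcoordK. Qed.

Lemma fimg_open c : open (fimg c).
Proof.
apply: openI.
- apply: (@open_comp _ _ (fun x : 'rV[R]_(1 + n) => x 0 (lshift n 0))).
    by move=> x _; exact: coord_continuous.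
  exact: tbase_open.
- apply: (@open_comp _ _ rsubmx); last exact: mcoord_open.
  by move=> x _; exact: continuous_rsubmx.
Qed.

Lemma fdom_open c : open (fdom c).
Proof.
have oD : open (@bproj R n B @^-1` tbase c.1).
  by apply: open_comp; [move=> e _; exact: bproj_continuous|exact: tbase_open].
have := @tfib_continuous R n B c.1; rewrite continuous_open_subspace // => tC.
rewrite openE => e [be me]; apply: filterI.
  exact: open_nbhs_nbhs.
apply: (tC e); first by rewrite inE.
by apply: open_nbhs_nbhs; split=> //; exact: mdom_open.
Qed.

Lemma fdom_at e : fdom (fchart_at e) e.
Proof. by split; [exact: tbase_triv_at|exact: mdom_chart_at]. Qed.

Lemma fcoord_proj c e : fcoord c e 0 (lshift n 0) = bproj e.
Proof. by rewrite row_mxEl mxE eqxx. Qed.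

Lemma fcoord_img c e : fdom c e -> fimg c (fcoord c e).
Proof.
by move=> [be me]; split; rewrite ?fcoord_proj // /fcoord row_mxKr; exists (tfib c.1 e).
Qed.

Lemma finv_dom c x : fimg c x -> fdom c (finv c x).
Proof.
move=> [tx /minvK[dx _]]; split; first by rewrite bproj_tinv.
by rewrite /finv tfib_tinv.
Qed.

Lemma finvK c x : fimg c x -> fcoord c (finv c x) = x.
Proof.
move=> [tx /minvK[_ xx]]; rewrite /fcoord /finv bproj_tinv // tfib_tinv // xx.
rewrite -[RHS]hsubmxK; congr row_mx.
by apply/matrixP => i j; rewrite !ord1 !mxE eqxx.
Qed.

Lemma fcoordK c e : fdom c e -> finv c (fcoord c e) = e.
Proof.
by move=> [be me]; rewrite /finv fcoord_proj row_mxKr mcoordK // tfibK.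
Qed.

Lemma finv_continuous c x : fimg c x -> {for x, continuous (@finv R n B c)}.
Proof.
move=> [tx ix].
have t_cont : (fun y : 'rV[R]_(1 + n) => y 0 (lshift n 0)) @ x --> x 0 (lshift n 0).
  exact: coord_continuous.
have q_cont : (fun y : 'rV[R]_(1 + n) => minv c.2 (rsubmx y)) @ x -->
    minv c.2 (rsubmx x).
  have := @minv_continuous _ _ _ c.2.
  rewrite continuous_open_subspace; last exact: mcoord_open.
  move=> mC; apply: (@continuous_comp _ _ _ rsubmx (minv c.2)).
    exact: continuous_rsubmx.
  by apply: mC; rewrite inE.
have oD : open (tbase c.1 `*` [set: bfibre B]).
  rewrite (_ : _ `*` _ = fst @^-1` tbase c.1); last first.
    by apply/seteqP; split=> [[t y] []|[t y]].
  by apply: open_comp => [[t y] _|]; [exact: cvg_fst|exact: tbase_open].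
have := @tinv_continuous _ _ B c.1; rewrite continuous_open_subspace // => tC.
have {tC} := tC (x 0 (lshift n 0), minv c.2 (rsubmx x)).
rewrite inE => /(_ (conj tx I)) tC.
apply: (@continuous_comp _ _ _
  (fun y : 'rV[R]_(1 + n) => (y 0 (lshift n 0), minv c.2 (rsubmx y)))
  (fun ty : R * bfibre B => tinv c.1 ty.1 ty.2) x _ tC).
exact: cvg_pair t_cont q_cont.
Qed.

Lemma fcoord_finv_diff c c' x : fimg c x -> fdom c' (finv c x) ->
  differentiable (fcoord c' \o finv c) x.
Proof.
move=> ix [bx mx]; have [tx rx] := ix; rewrite /= bproj_tinv // in bx.
have dq := smooth_map_differentiable (triv_smooth c.1 c'.1 c.2 c'.2)
  (And4 tx bx rx mx).
apply: differentiable_rV => k; case: (split_ordP k) => j ->.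
  rewrite ord1; apply: (@near_eq_differentiable _ _ _
    (fun y : 'rV[R]_(1 + n) => y 0 (lshift n 0))); last exact: differentiable_coord.
  apply: (open_nbhs_near (@fimg_open c) ix) => y [ty _].
  by rewrite /= fcoord_proj bproj_tinv.
rewrite (_ : (fun y => _) = fun y => mcoord c'.2 (tfib c'.1 (finv c y)) 0 j).
  exact: differentiable_component dq.
by apply/funext => y; rewrite /= row_mxEr.
Qed.

Lemma ftransJ_id c x : fimg c x -> ftransJ c c x = 1%:M.
Proof.
move=> ix; rewrite /ftransJ jacobianE; last first.
  exact: fcoord_finv_diff (finv_dom ix).
apply/matrixP => i j; rewrite !mxE -(partial_coord _ _ x).
apply: near_eq_partial; apply: (open_nbhs_near (@fimg_open c) ix) => y iy.
by rewrite /= finvK.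
Qed.

Lemma ftransJ_comp c c' x : fimg c x -> fdom c' (finv c x) ->
  ftransJ c c' x *m ftransJ c' c (fcoord c' (finv c x)) = 1%:M.
Proof.
move=> ix dx.
have dcx : fdom c (finv c' (fcoord c' (finv c x))).
  by rewrite fcoordK //; exact: finv_dom.
have d1 := fcoord_finv_diff ix dx.
have d2 := fcoord_finv_diff (fcoord_img dx) dcx.
rewrite -[RHS](ftransJ_id ix) /ftransJ -(jacobian_comp d1 d2).
rewrite (jacobianE (differentiable_comp d1 d2)).
rewrite (jacobianE (fcoord_finv_diff ix (finv_dom ix))).
apply/matrixP => i j; rewrite !mxE; apply: near_eq_partial.
have : \near x, fdom c' (finv c x).
  apply: (finv_continuous ix); apply: open_nbhs_nbhs; split=> //.
  exact: fdom_open.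
by apply: filterS => y dy; rewrite /= fcoordK.
Qed.

(** The coordinate t is common to all fibred charts. *)
Lemma ftransJ_block c c' x : fimg c x -> fdom c' (finv c x) ->
  ftransJ c c' x = block_mx 1%:M (ursubmx (ftransJ c c' x))
                            0 (drsubmx (ftransJ c c' x)).
Proof.
move=> ix dx; rewrite -[LHS]submxK.
have E i : ftransJ c c' x i (lshift n 0) = (i == lshift n 0)%:R.
  rewrite /ftransJ jacobianE; last exact: fcoord_finv_diff.
  rewrite mxE -(partial_coord _ _ x); apply: near_eq_partial.
  apply: (open_nbhs_near (@fimg_open c) ix) => y [ty _].
  by rewrite /= fcoord_proj bproj_tinv.
congr block_mx.
  by apply/matrixP => i j; rewrite 2![LHS]mxE !ord1 E mxE.
by apply/matrixP => i j; rewrite 2![LHS]mxE !ord1 E mxE eq_rlshift.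
Qed.

End Charts.

(** * Coordinates on the bundles over E *)

Lemma block_affine_inverse (F : comUnitRingType) n (a a' : 'rV[F]_n) (A A' : 'M[F]_n) :
  block_mx 1%:M a 0 A *m block_mx 1%:M a' 0 A' = 1%:M :> 'M[F]_(1 + n) ->
  [/\ A *m A' = 1%:M, A' *m A = 1%:M & a *m A' = - a'].
Proof.
rewrite mulmx_block !mul1mx !mul0mx !mulmx0 !addr0 !add0r => E.
have [_ aa _ AA] := eq_block_mx (etrans E (@scalar_mx_block F 1 n 1)).
by split=> //; [exact: mulmx1C|apply/eqP; rewrite -addr_eq0 addrC aa].
Qed.

Section Fibres.
Context {R : realType} {n : nat} {B : fibre_bundle R n}.
Implicit Types (c : fchart B) (e : B) (x : 'rV[R]_(1 + n)).

(** The blocks of the Jacobian matrices between a chart c and the preferred chart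
    at e, taken at e.  With A = fibre_jac and a = fibre_drift, velocities v and
    momenta p in c are related to v0 and p0 in the preferred chart by
    v0 = a + v A and p = p0 A^T.  The versions with a final V belong to the
    inverse change of charts. *)
Definition fibre_jac c e : 'M[R]_n :=
  drsubmx (ftransJ c (fchart_at e) (fcoord c e)).

Definition fibre_drift c e : 'rV[R]_n :=
  ursubmx (ftransJ c (fchart_at e) (fcoord c e)).

Definition fibre_jacV c e : 'M[R]_n :=
  drsubmx (ftransJ (fchart_at e) c (fcoord (fchart_at e) e)).

Definition fibre_driftV c e : 'rV[R]_n :=
  ursubmx (ftransJ (fchart_at e) c (fcoord (fchart_at e) e)).

Section Point.
Variables (c : fchart B) (e : B).
Hypothesis ce : fdom c e.
Local Notation c0 := (fchart_at e).
Local Notation A := (fibre_jac c e).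
Local Notation a := (fibre_drift c e).
Local Notation A' := (fibre_jacV c e).
Local Notation a' := (fibre_driftV c e).

Lemma to_fchart_at :
  ftransJ c c0 (fcoord c e) = block_mx 1%:M a 0 A.
Proof.
by apply: ftransJ_block; rewrite ?fcoordK //; [exact: fcoord_img|exact: fdom_at].
Qed.

Lemma from_fchart_at :
  ftransJ c0 c (fcoord c0 e) = block_mx 1%:M a' 0 A'.
Proof.
have de := @fdom_at _ _ _ e.
by apply: ftransJ_block; rewrite ?fcoordK //; exact: fcoord_img.
Qed.

Lemma fchart_at_inverse : [/\ A *m A' = 1%:M, A' *m A = 1%:M & a *m A' = - a'].
Proof.
have de := @fdom_at _ _ _ e.
have := @ftransJ_comp _ _ _ c c0 (fcoord c e).
rewrite fcoordK // => /(_ (fcoord_img ce) de).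
rewrite to_fchart_at from_fchart_at; exact: block_affine_inverse.
Qed.

Lemma fibre_jac_unit : A \in unitmx.
Proof.
have [AA _ _] := fchart_at_inverse; have [uA _] := mulmx1_unit AA; exact: uA.
Qed.

Lemma fibre_jacV_unit : A' \in unitmx.
Proof.
have [AA _ _] := fchart_at_inverse; have [_ uA'] := mulmx1_unit AA; exact: uA'.
Qed.

Lemma jet_inv_at v : jet_inv c (row_mx (fcoord c e) v) = (e, a + v *m A).
Proof.
rewrite /jet_inv row_mxKl row_mxKr fcoordK // to_fchart_at mul_row_block.
by rewrite row_mxKr mul1mx.
Qed.

Lemma jet_coord_at v : jet_coord c (e, v) = row_mx (fcoord c e) (a' + v *m A').
Proof.
by rewrite /jet_coord /= from_fchart_at mul_row_block row_mxKr mul1mx.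
Qed.

Lemma dual_inv_at p : dual_inv c (row_mx (fcoord c e) p) = (e, p *m A'^T).
Proof. by rewrite /dual_inv row_mxKl row_mxKr fcoordK. Qed.

Lemma dual_coord_at p :
  dual_coord c (e, p) = row_mx (fcoord c e) (p *m A^T).
Proof. by []. Qed.

Lemma cot_coord_at (u : 'M[R]_1) p : cot_coord c (e, row_mx u p) =
  row_mx (fcoord c e) (row_mx (u + p *m a^T) (p *m A^T)).
Proof.
rewrite /cot_coord /= to_fchart_at tr_block_mx mul_row_block.
by rewrite trmx1 trmx0 mulmx1 mulmx0 add0r.
Qed.

Lemma cot_inv_at (u : 'M[R]_1) p : cot_inv c (row_mx (fcoord c e) (row_mx u p)) =
  (e, row_mx (u + p *m a'^T) (p *m A'^T)).
Proof.
rewrite /cot_inv row_mxKl row_mxKr fcoordK // from_fchart_at tr_block_mx mul_row_block.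
by rewrite trmx1 trmx0 mulmx1 mulmx0 add0r.
Qed.

End Point.

Lemma dual_coordK c (b : dual B) : fdom c b.1 -> dual_inv c (dual_coord c b) = b.
Proof.
case: b => e p ce; have [_ AA _] := fchart_at_inverse ce.
rewrite [dual_coord _ _]/(row_mx (fcoord c e) (p *m (fibre_jac c e)^T)).
by rewrite dual_inv_at // -mulmxA -trmx_mul AA trmx1 mulmx1.
Qed.

Lemma fibre_jac_at e : fibre_jac (fchart_at e) e = 1%:M.
Proof.
rewrite /fibre_jac ftransJ_id; last exact/fcoord_img/fdom_at.
by rewrite [1%:M](@scalar_mx_block R 1 n) block_mxKdr.
Qed.

Lemma fibre_drift_at e : fibre_drift (fchart_at e) e = 0.
Proof.
rewrite /fibre_drift ftransJ_id; last exact/fcoord_img/fdom_at.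
by rewrite [1%:M](@scalar_mx_block R 1 n) block_mxKur.
Qed.

Lemma fibre_jacV_at e : fibre_jacV (fchart_at e) e = 1%:M.
Proof. exact: fibre_jac_at. Qed.

Lemma fibre_driftV_at e : fibre_driftV (fchart_at e) e = 0.
Proof. exact: fibre_drift_at. Qed.

Lemma jet_coord_fchart_at (j : jet B) :
  jet_coord (fchart_at j.1) j = row_mx (fcoord (fchart_at j.1) j.1) j.2.
Proof.
case: j => e v; rewrite jet_coord_at; last exact: fdom_at.
by rewrite fibre_driftV_at fibre_jacV_at add0r mulmx1.
Qed.

Lemma jet_inv_fchart_at e v :
  jet_inv (fchart_at e) (row_mx (fcoord (fchart_at e) e) v) = (e, v).
Proof.
rewrite jet_inv_at; last exact: fdom_at.
by rewrite fibre_drift_at fibre_jac_at add0r mulmx1.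
Qed.

End Fibres.

(** * Chart expressions of the Legendre map and of the Hamiltonian *)

Section ChartExpressions.
Context {R : realType} {n : nat} {B : fibre_bundle R n}.
Implicit Types (c : fchart B) (e : B) (v p : 'rV[R]_n).

Lemma fimg_split c (z : 'rV[R]_(1 + n + n)) : fimg c (lsubmx z) ->
  exists e v, fdom c e /\ z = row_mx (fcoord c e) v.
Proof.
move=> iz; exists (finv c (lsubmx z)), (rsubmx z).
by split; [exact: finv_dom|rewrite finvK // hsubmxK].
Qed.

Lemma fimg_row c e v : fdom c e ->
  [set z : 'rV[R]_(1 + n + n) | fimg c (lsubmx z)] (row_mx (fcoord c e) v).
Proof. by move=> ce; rewrite /= row_mxKl; exact: fcoord_img. Qed.

Section Lagrangian.
Variable L : jet B -> R.
Hypothesis sL : smooth_jet L.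

Lemma jet_diff c e v : fdom c e ->
  differentiable (L \o jet_inv c) (row_mx (fcoord c e) v).
Proof. by move=> ce; apply: smooth_differentiable (sL c) _; exact: fimg_row. Qed.

(** Momenta transform as vertical covectors, as L is a function on the jets. *)
Lemma momentum_at c e v : fdom c e ->
  vgrad (L \o jet_inv c) (row_mx (fcoord c e) v) =
  vgrad (L \o jet_inv (fchart_at e))
        (row_mx (fcoord (fchart_at e) e) (fibre_drift c e + v *m fibre_jac c e))
    *m (fibre_jac c e)^T.
Proof.
move=> ce; apply: vgrad_affine.
  by move=> u; rewrite /comp jet_inv_at // jet_inv_fchart_at.
by apply: jet_diff; exact: fdom_at.
Qed.

Lemma legendreE e v : legendre L (e, v) =
  (e, vgrad (L \o jet_inv (fchart_at e)) (row_mx (fcoord (fchart_at e) e) v)).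
Proof. by rewrite /legendre jet_coord_fchart_at. Qed.

(** At points over e the Legendre map is defined in the preferred chart at e,
    which varies with e without any continuity; in a fixed chart it is
    nevertheless given by the usual formula. *)
Lemma legendre_coord c z : fimg c (lsubmx z) ->
  dual_coord c (legendre L (jet_inv c z)) = leg (L \o jet_inv c) z.
Proof.
move=> /fimg_split[e [v [ce ->]]].
rewrite (jet_inv_at ce) legendreE dual_coord_at /leg row_mxKl; congr row_mx.
exact: esym (momentum_at v ce).
Qed.

Lemma dual_inv_leg c z : fimg c (lsubmx z) ->
  dual_inv c (leg (L \o jet_inv c) z) = legendre L (jet_inv c z).
Proof.
move=> iz; rewrite -legendre_coord // dual_coordK //.
exact: finv_dom.
Qed.

Lemma hessian_at c e v : fdom c e ->
  vjac (vgrad (L \o jet_inv c)) (row_mx (fcoord c e) v) =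
  fibre_jac c e *m
  vjac (vgrad (L \o jet_inv (fchart_at e)))
    (row_mx (fcoord (fchart_at e) e) (fibre_drift c e + v *m fibre_jac c e))
  *m (fibre_jac c e)^T.
Proof.
move=> ce; apply: vjac_affine; first by move=> u; exact: momentum_at.
apply: (smooth_map_differentiable (vgrad_smooth (@fimg_open _ _ _ (fchart_at e)) (sL _))).
by apply: fimg_row; exact: fdom_at.
Qed.

(** This turns the rank hypothesis, made in one preferred chart at each point,
    into one on the Hessian matrix, which passes to every chart. *)
Lemma legendre_rankE (j : jet B) : legendre_rank L j =
  (1 + n + \rank (vjac (vgrad (L \o jet_inv (fchart_at j.1)))
                  (jet_coord (fchart_at j.1) j)))%N.
Proof.
set c := fchart_at j.1; set z := jet_coord c j.
have Uz : fimg c (lsubmx z).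
  by rewrite /z jet_coord_fchart_at row_mxKl; exact/fcoord_img/fdom_at.
have oP := @fimg_open _ _ _ c.
rewrite -(rank_jacobian_leg oP (sL c) Uz) /legendre_rank -/c -/z.
suff JE : 'J (leg (L \o jet_inv c)) z =
    'J (dual_coord c \o legendre L \o jet_inv c) z.
  exact: (congr1 (@mxrank R _ _) (esym JE)).
apply: near_eq_jacobian; last exact: leg_diff oP (sL c) _ Uz.
apply: (open_nbhs_near (lsubmx_open oP) Uz) => y Uy.
exact: esym (legendre_coord Uy).
Qed.

End Lagrangian.

Lemma dual_inv_at_jac c e p : fdom c e ->
  dual_inv c (row_mx (fcoord c e) p) =
  dual_inv (fchart_at e) (row_mx (fcoord (fchart_at e) e) (0 + p *m (fibre_jacV c e)^T)).
Proof.
move=> ce; rewrite (dual_inv_at ce) (dual_inv_at (fdom_at e)).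
by rewrite (fibre_jacV_at e) trmx1 mulmx1 add0r.
Qed.

Lemma vgrad_dual_at (f : dual B -> R) c e p : smooth_dual f -> fdom c e ->
  vgrad (f \o dual_inv c) (row_mx (fcoord c e) p) =
  vgrad (f \o dual_inv (fchart_at e))
    (row_mx (fcoord (fchart_at e) e) (p *m (fibre_jacV c e)^T)) *m fibre_jacV c e.
Proof.
move=> sf ce.
have := @vgrad_affine _ _ _ (f \o dual_inv c) (f \o dual_inv (fchart_at e))
  (fcoord c e) (fcoord (fchart_at e) e) 0 p (fibre_jacV c e)^T.
rewrite trmxK add0r; apply.
  by move=> u; rewrite /comp dual_inv_at_jac.
apply: smooth_differentiable (sf _) _; apply: fimg_row; exact: fdom_at.
Qed.

Lemma vdphi_at m (phi : 'I_m -> dual B -> R) c e p :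
  (forall I, smooth_dual (phi I)) -> fdom c e ->
  vdphi (fun I => phi I \o dual_inv c) (row_mx (fcoord c e) p) =
  vdphi (fun I => phi I \o dual_inv (fchart_at e))
    (row_mx (fcoord (fchart_at e) e) (p *m (fibre_jacV c e)^T)) *m fibre_jacV c e.
Proof.
move=> sphi ce; apply/row_matrixP => I; rewrite row_mul.
have rowE' c' w : row I (vdphi (fun I => phi I \o dual_inv c') w) =
    vgrad (phi I \o dual_inv c') w by apply/rowP => k; rewrite !mxE.
apply: etrans (rowE' c _) _; apply: etrans (vgrad_dual_at _ (sphi I) ce) _.
exact: (congr1 (fun w => w *m fibre_jacV c e) (esym (rowE' _ _))).
Qed.

Section HamiltonianSection.
Variable h : dual B -> cot B.
Hypothesis hmu : forall b, mu (h b) = b.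
Hypothesis hsmooth : forall c, smooth_map_on [set z | fimg c (lsubmx z)]
  (cot_coord c \o h \o dual_inv c).

(** The function H in h(t, q, p) = (t, q, - H, p). *)
Definition ham c (z : 'rV[R]_(1 + n + n)) : R :=
  - cot_coord c (h (dual_inv c z)) 0 (rshift (1 + n) (lshift n 0)).

Lemma ham_smooth c : smooth_on [set z | fimg c (lsubmx z)] (ham c).
Proof.
apply: smoothN; first exact/lsubmx_open/fimg_open.
exact: hsmooth.
Qed.

Lemma section_split e p : h (e, p) = (e, row_mx (lsubmx (h (e, p)).2) p).
Proof.
case E : (h (e, p)) => [e' w]; have := hmu (e, p); rewrite E /mu /= => -[-> <-].
by rewrite hsubmxK.
Qed.

Lemma ham_at c e p : fdom c e ->
  ham c (row_mx (fcoord c e) p) =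
  - (lsubmx (h (e, p *m (fibre_jacV c e)^T)).2
     + p *m (fibre_jacV c e)^T *m (fibre_drift c e)^T) 0 0.
Proof.
move=> ce; rewrite /ham (dual_inv_at ce) section_split (cot_coord_at ce).
by rewrite row_mxEr row_mxEl row_mxKl.
Qed.

Lemma ham_fchart_at e p :
  ham (fchart_at e) (row_mx (fcoord (fchart_at e) e) p) = - lsubmx (h (e, p)).2 0 0.
Proof.
rewrite (ham_at _ (fdom_at e)) fibre_jacV_at fibre_drift_at.
by rewrite trmx0 mulmx0 addr0 trmx1 mulmx1.
Qed.

(** The inhomogeneous term comes from u = u0 + p0 . a: Hamiltonians in
    different charts differ by a function linear in the momenta, whose
    derivative compensates the drift of the velocities. *)
Lemma vgrad_ham_at c e p : fdom c e ->
  vgrad (ham c) (row_mx (fcoord c e) p) =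
  (vgrad (ham (fchart_at e))
    (row_mx (fcoord (fchart_at e) e) (p *m (fibre_jacV c e)^T)) - fibre_drift c e)
  *m fibre_jacV c e.
Proof.
move=> ce.
have dH u : differentiable (ham (fchart_at e)) (row_mx (fcoord (fchart_at e) e) u).
  by apply: smooth_differentiable (ham_smooth _) _; apply/fimg_row/fdom_at.
rewrite -(vgrad_sub_pairing _ (dH _)).
have := @vgrad_affine _ _ _ (ham c)
  (fun w => ham (fchart_at e) w - (rsubmx w *m (fibre_drift c e)^T) 0 0)
  (fcoord c e) (fcoord (fchart_at e) e) 0 p (fibre_jacV c e)^T.
rewrite trmxK add0r; apply.
  move=> u; rewrite add0r (ham_at _ ce) ham_fchart_at row_mxKr.
  by rewrite [X in - X = _]mxE opprD.
exact: differentiableB (dH _) (pairing_diff _ _).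
Qed.

End HamiltonianSection.

End ChartExpressions.

(** * The multipliers as functions on the jet bundle *)

Section ConstrainedLagrangian.
Context {R : realType} {n m : nat} {B : fibre_bundle R n}.
Variables (L : jet B -> R) (phi : 'I_m -> dual B -> R) (h : dual B -> cot B).
Hypothesis sL : smooth_jet L.
Hypothesis phiP : complete_constraints L phi.
Hypothesis hP : hamiltonian_section L h.
Implicit Types (c : fchart B) (e : B) (v p : 'rV[R]_n).
Implicit Types z : 'rV[R]_(1 + n + n).

Definition chart_phi c I := phi I \o dual_inv c.

Let sphi c I : smooth_on [set z | fimg c (lsubmx z)] (chart_phi c I).
Proof. by have [sphi _ _ _] := phiP; exact: sphi. Qed.

Let sLc c : smooth_on [set z | fimg c (lsubmx z)] (L \o jet_inv c).
Proof. exact: sL. Qed.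

Let sHc c : smooth_on [set z | fimg c (lsubmx z)] (ham h c).
Proof. by have [_ sh _] := hP; exact: ham_smooth. Qed.

Let oPc c : open (fimg c).
Proof. exact: fimg_open. Qed.

(** The identity FL_hat = h o FL compares covectors; its dt-component in the
    chart c is the relation between the energy and H. *)
Lemma energy_at c e v : fdom c e ->
  ham h c (leg (L \o jet_inv c) (row_mx (fcoord c e) v)) =
  \sum_i v 0 i * vgrad (L \o jet_inv c) (row_mx (fcoord c e) v) 0 i
  - L (jet_inv c (row_mx (fcoord c e) v)).
Proof.
have [hmu sh hL] := hP => ce.
have ic : fimg c (lsubmx (row_mx (fcoord c e) v)) by rewrite row_mxKl; exact: fcoord_img.
rewrite /ham (dual_inv_leg sL ic) -hL.
set w := \sum_i _.
have Ew : w = (v *m (vgrad (L \o jet_inv c) (row_mx (fcoord c e) v))^T) 0 0.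
  by rewrite mxE; apply: eq_bigr => i _; rewrite [in RHS]mxE.
rewrite {}Ew (momentum_at sL v ce) (jet_inv_at ce) /legendre_hat /energy.
rewrite jet_coord_fchart_at.
set p0 := momentum _ _ _.
have -> : vgrad (L \o jet_inv (fchart_at e))
   (row_mx (fcoord (fchart_at e) e) (fibre_drift c e + v *m fibre_jac c e)) = p0 by [].
move: p0 => p0; rewrite (cot_coord_at ce) row_mxEr row_mxEl.
set w0 := fibre_drift c e + _; rewrite -[(e, w0).2]/w0.
have -> : \sum_i w0 0 i * p0 0 i = (w0 *m p0^T) 0 0.
  by rewrite [RHS]mxE; apply: eq_bigr => i _; rewrite [X in _ = _ * X]mxE.
have -> : (w0 *m p0^T) 0 0 = (p0 *m (fibre_drift c e)^T) 0 0
                           + (v *m (p0 *m (fibre_jac c e)^T)^T) 0 0.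
  rewrite /w0 mulmxDl [LHS]mxE trmx_mul trmxK mulmxA; congr (_ + _).
  by rewrite -[_ *m p0^T]trmxK trmx_mul trmxK [LHS]mxE.
rewrite [X in - X = _]mxE [X in - (X + _)]mxE eqxx mulr1n.
by rewrite opprD opprK addrC !addrA addNr add0r.
Qed.

Lemma chart_energy c z : fimg c (lsubmx z) ->
  ham h c (leg (L \o jet_inv c) z) =
  \sum_i rsubmx z 0 i * vgrad (L \o jet_inv c) z 0 i - (L \o jet_inv c) z.
Proof.
by move=> /fimg_split[e [v [ce ->]]]; rewrite energy_at // row_mxKr.
Qed.

Lemma chart_phi0 c I z : fimg c (lsubmx z) ->
  chart_phi c I (leg (L \o jet_inv c) z) = 0.
Proof.
have [_ /(_ _) S _ _] := phiP => iz; rewrite /chart_phi /comp (dual_inv_leg sL iz).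
have /S : ham_primary L (legendre L (jet_inv c z)) by exists (jet_inv c z).
exact.
Qed.

Lemma vdphi_free_at e v :
  row_free (vdphi (chart_phi (fchart_at e))
    (leg (L \o jet_inv (fchart_at e)) (row_mx (fcoord (fchart_at e) e) v))).
Proof.
have ie : fimg (fchart_at e) (lsubmx (row_mx (fcoord (fchart_at e) e) v)).
  by rewrite row_mxKl; exact/fcoord_img/fdom_at.
have free := dphi_vdphi_free (@oPc (fchart_at e)) (sLc (fchart_at e))
  (sphi (fchart_at e)) (fun I z => @chart_phi0 (fchart_at e) I z) ie.
apply: free.
rewrite -(legendre_coord sL ie) jet_inv_fchart_at.
have [_ _ fD _] := phiP; have := fD (legendre L (e, v)).
by apply; exists (e, v).
Qed.

Lemma leg_at c e v : fdom c e ->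
  leg (L \o jet_inv c) (row_mx (fcoord c e) v) =
  row_mx (fcoord c e) (vgrad (L \o jet_inv c) (row_mx (fcoord c e) v)).
Proof. by rewrite /leg row_mxKl. Qed.

Lemma momentum_back c e v : fdom c e ->
  vgrad (L \o jet_inv c) (row_mx (fcoord c e) v) *m (fibre_jacV c e)^T =
  vgrad (L \o jet_inv (fchart_at e))
        (row_mx (fcoord (fchart_at e) e) (fibre_drift c e + v *m fibre_jac c e)).
Proof.
move=> ce; have [_ AA _] := fchart_at_inverse ce.
apply: (etrans (congr1 (fun w => w *m (fibre_jacV c e)^T) (momentum_at sL v ce))).
move: (vgrad _ _) => p.
by rewrite -mulmxA -(trmx_mul (fibre_jacV c e)) AA trmx1 mulmx1.
Qed.

Lemma leg_back c e v : fdom c e ->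
  row_mx (fcoord (fchart_at e) e)
    (vgrad (L \o jet_inv c) (row_mx (fcoord c e) v) *m (fibre_jacV c e)^T) =
  leg (L \o jet_inv (fchart_at e)) (row_mx (fcoord (fchart_at e) e)
      (fibre_drift c e + v *m fibre_jac c e)).
Proof.
move=> ce; apply: etrans (esym (leg_at _ (fdom_at e))).
exact: (congr1 (row_mx _) (momentum_back v ce)).
Qed.

Lemma chart_vdphi_at c e v : fdom c e ->
  vdphi (chart_phi c) (leg (L \o jet_inv c) (row_mx (fcoord c e) v)) =
  vdphi (chart_phi (fchart_at e)) (leg (L \o jet_inv (fchart_at e))
    (row_mx (fcoord (fchart_at e) e) (fibre_drift c e + v *m fibre_jac c e)))
  *m fibre_jacV c e.
Proof.
move=> ce; have [sp _ _ _] := phiP.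
apply: (etrans (congr1 (vdphi (chart_phi c)) (leg_at v ce))).
apply: (etrans (vdphi_at _ sp ce)).
exact: (congr1 (fun w => vdphi (chart_phi (fchart_at e)) w *m fibre_jacV c e)
               (leg_back v ce)).
Qed.

Lemma chart_vdphi_free c z : fimg c (lsubmx z) ->
  row_free (vdphi (chart_phi c) (leg (L \o jet_inv c) z)).
Proof.
move=> /fimg_split[e [v [ce ->]]]; rewrite (chart_vdphi_at v ce) /row_free.
by rewrite mxrankMfree ?row_free_unit ?fibre_jacV_unit //; exact: vdphi_free_at.
Qed.

Lemma chart_hessian_rank c z : fimg c (lsubmx z) ->
  (\rank (vjac (vgrad (L \o jet_inv c)) z) + m = n)%N.
Proof.
move=> /fimg_split[e [v [ce ->]]].
have uA := fibre_jac_unit ce.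
have [_ _ _ rk] := phiP.
have := rk (e, fibre_drift c e + v *m fibre_jac c e).
rewrite (legendre_rankE sL) jet_coord_fchart_at -addnA => /addnI rk0.
apply: (etrans (congr1 (fun W => (\rank W + m)%N) (hessian_at sL v ce))).
move: (vjac _ _) rk0 => W rk0.
rewrite mxrankMfree ?row_free_unit ?unitmx_tr //.
by rewrite eqmxMfull ?row_full_unit.
Qed.

(** Both sides of velocity - dH/dp = multiplier . dphi/dp are multiplied by the
    same invertible matrix under a change of charts, and the coefficients are
    unique. *)
Lemma chart_multiplier_at c e v : fdom c e ->
  multiplier (L \o jet_inv c) (ham h c) (chart_phi c) (row_mx (fcoord c e) v) =
  multiplier (L \o jet_inv (fchart_at e)) (ham h (fchart_at e))
    (chart_phi (fchart_at e))
    (row_mx (fcoord (fchart_at e) e) (fibre_drift c e + v *m fibre_jac c e)).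
Proof.
move=> ce; have [AA _ _] := fchart_at_inverse ce.
have [hmu sh hL] := hP.
have ic : fimg c (lsubmx (row_mx (fcoord c e) v)).
  by rewrite row_mxKl; exact: fcoord_img.
have [_ E] := defect_split (@oPc c) (sLc c) (sHc c) (sphi c)
  (fun z => @chart_energy c z) (fun I z => @chart_phi0 c I z)
  (fun z => @chart_vdphi_free c z) (fun z => @chart_hessian_rank c z) ic.
apply: (multiplierP (fun z => @chart_vdphi_free (fchart_at e) z)).
  by rewrite /= row_mxKl; exact/fcoord_img/fdom_at.
have EH := etrans (congr1 (vgrad (ham h c)) (leg_at v ce))
  (etrans (vgrad_ham_at hmu sh _ ce)
    (congr1 (fun w => (vgrad (ham h (fchart_at e)) w - fibre_drift c e)
                      *m fibre_jacV c e) (leg_back v ce))).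
rewrite [X in _ - X = _]EH [X in _ = _ *m X](chart_vdphi_at v ce) in E.
move: E; rewrite !row_mxKr.
move: (vgrad _ _) (vdphi _ _) (multiplier _ _ _ _) => Y V lam E.
apply: (can_inj (mulmxK (fibre_jacV_unit ce))).
rewrite -[RHS]mulmxA -E !mulmxBl mulmxDl -(mulmxA v) AA mulmx1.
by rewrite opprB [in RHS]addrA [v + _]addrC.
Qed.

Lemma chart_defect c z : fimg c (lsubmx z) ->
  let lam := multiplier (L \o jet_inv c) (ham h c) (chart_phi c) z in
  let w := leg (L \o jet_inv c) z in
  - bgrad (L \o jet_inv c) z - bgrad (ham h c) w = lam *m bdphi (chart_phi c) w /\
  rsubmx z - vgrad (ham h c) w = lam *m vdphi (chart_phi c) w.
Proof.
exact: (defect_split (@oPc c) (sLc c) (sHc c) (sphi c)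
  (fun z => @chart_energy c z) (fun I z => @chart_phi0 c I z)
  (fun z => @chart_vdphi_free c z) (fun z => @chart_hessian_rank c z)).
Qed.

Definition jet_multiplier I (j : jet B) : R :=
  let c := fchart_at j.1 in
  multiplier (L \o jet_inv c) (ham h c) (chart_phi c) (jet_coord c j) 0 I.

Lemma jet_multiplierE c I z : fimg c (lsubmx z) ->
  jet_multiplier I (jet_inv c z) =
  multiplier (L \o jet_inv c) (ham h c) (chart_phi c) z 0 I.
Proof.
move=> /fimg_split[e [v [ce ->]]]; rewrite (jet_inv_at ce) /jet_multiplier.
rewrite jet_coord_fchart_at.
exact: (congr1 (fun w : 'rV[R]_m => w 0 I) (esym (chart_multiplier_at v ce))).
Qed.

Lemma jet_multiplier_smooth I : smooth_jet (jet_multiplier I).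
Proof.
move=> c; apply: (smooth_congr (lsubmx_open (@oPc c)) _
  (multiplier_smooth (@oPc c) (sLc c) (sHc c) (sphi c)
                     (fun z => @chart_vdphi_free c z) I)).
by move=> z iz; rewrite /comp (jet_multiplierE _ iz).
Qed.

(** A point of the jet bundle is needed; it exists as the projection of E is
    surjective. *)
Lemma jet_multiplier_not_projectable I : ~ projectable L (jet_multiplier I).
Proof.
move=> [g sg gE]; have [e _] := @bproj_surjective _ _ B 0.
pose c := fchart_at e; pose z := row_mx (fcoord c e) (0 : 'rV[R]_n).
have iz : fimg c (lsubmx z) by rewrite row_mxKl; exact/fcoord_img/fdom_at.
apply: (multiplier_not_basic (@oPc c) (sLc c) (sHc c) (sphi c)
  (fun z => @chart_energy c z) (fun I z => @chart_phi0 c I z)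
  (fun z => @chart_vdphi_free c z) (fun z => @chart_hessian_rank c z)
  (I := I) (g := g \o dual_inv c) iz).
  apply: smooth_differentiable (sg c) _; exact: legU.
apply: (open_nbhs_near (lsubmx_open (@oPc c)) iz) => y iy.
rewrite -(jet_multiplierE _ iy) gE /comp (dual_inv_leg sL iy).
by [].
Qed.

End ConstrainedLagrangian.

(** * Poisson brackets in coordinates *)

Section Brackets.
Context {R : realType} {n : nat} {B : fibre_bundle R n}.

(** The coordinate expression of the projection of covectors to the dual
    bundle. *)
Definition drop_u (y : 'rV[R]_(1 + n + (1 + n))) : 'rV[R]_(1 + n + n) :=
  row_mx (lsubmx y) (rsubmx (rsubmx y)).

Lemma drop_u_linear (k : R) y y' :
  drop_u (k *: y + y') = k *: drop_u y + drop_u y'.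
Proof.
by rewrite /drop_u scale_row_mx add_row_mx; congr row_mx; apply/rowP => i; rewrite !mxE.
Qed.

Lemma drop_u_base i : drop_u (delta_mx 0 (lshift (1 + n) i)) = delta_mx 0 (lshift n i).
Proof.
apply/rowP => k; case: (split_ordP k) => j ->.
  by rewrite row_mxEl !mxE !(inj_eq (@lshift_inj _ _)).
by rewrite row_mxEr !mxE eq_rlshift eq_rlshift.
Qed.

Lemma drop_u_u : drop_u (delta_mx 0 (rshift (1 + n) (lshift n 0))) = 0.
Proof.
apply/rowP => k; case: (split_ordP k) => j ->.
  by rewrite row_mxEl !mxE eq_lrshift.
by rewrite row_mxEr !mxE (inj_eq (@rshift_inj _ _)) eq_rlshift.
Qed.

Lemma drop_u_p k :
  drop_u (delta_mx 0 (rshift (1 + n) (rshift 1 k))) = delta_mx 0 (rshift (1 + n) k).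
Proof.
apply/rowP => l; case: (split_ordP l) => j ->.
  by rewrite row_mxEl !mxE eq_lrshift eq_lrshift.
by rewrite row_mxEr !mxE !(inj_eq (@rshift_inj _ _)).
Qed.

Lemma partial_drop_u i (K : 'rV[R]_(1 + n + n) -> R) y :
  partial i (K \o drop_u) y = 'D_(drop_u (delta_mx 0 i)) K (drop_u y).
Proof. by apply: derive_comp_affine => k; exact: drop_u_linear. Qed.

Lemma drop_u_diff y : differentiable drop_u y.
Proof.
apply: differentiable_rV => k; case: (split_ordP k) => j ->.
  rewrite (_ : (fun y => _) = fun y : 'rV[R]_(1 + n + (1 + n)) => y 0 (lshift _ j)).
    exact: differentiable_coord.
  by apply/funext => x; rewrite row_mxEl mxE.
rewrite (_ : (fun y => _) =
    fun y : 'rV[R]_(1 + n + (1 + n)) => y 0 (rshift _ (rshift 1 j))).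
  exact: differentiable_coord.
by apply/funext => x; rewrite row_mxEr !mxE.
Qed.

Definition coord_bracket (F K : 'rV[R]_(1 + n + n) -> R) w : R :=
  \sum_(k < n)
    (partial (lshift n (rshift 1 k)) F w * partial (rshift (1 + n) k) K w
     - partial (rshift (1 + n) k) F w * partial (lshift n (rshift 1 k)) K w).

Lemma coord_bracketC F K w : coord_bracket F K w = - coord_bracket K F w.
Proof.
rewrite /coord_bracket -sumrN; apply: eq_bigr => k _.
by rewrite opprB mulrC [X in _ - X]mulrC.
Qed.

Lemma mu_cot_inv c (y : 'rV[R]_(1 + n + (1 + n))) : fimg c (lsubmx y) ->
  mu (cot_inv c y : cot B) = dual_inv c (drop_u y).
Proof.
move=> iy; rewrite /drop_u -(finvK iy) (dual_inv_at (finv_dom iy)).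
rewrite -{1}[y]hsubmxK -{1}(finvK iy) -[rsubmx y in LHS]hsubmxK.
by rewrite (cot_inv_at (finv_dom iy)) /mu /= row_mxKr.
Qed.

Lemma drop_u_cot_coord (a : cot B) :
  drop_u (cot_coord (fchart_at a.1) a) = dual_coord (fchart_at a.1) (mu a).
Proof.
case: a => e w; rewrite -[w]hsubmxK (cot_coord_at (fdom_at e)) /drop_u.
by rewrite row_mxKl !row_mxKr /mu /= row_mxKr dual_coord_at.
Qed.

(** Covers both uses of the bracket with functions pulled back from the dual
    bundle: k = 0 when g is itself such a function, k = 1 when g = u + H. *)
Lemma poisson_cot_formula (G : dual B -> R) (g : cot B -> R) (k : R) K (a : cot B) :
  let c := fchart_at a.1 in
  let w := dual_coord c (mu a) in
  (forall y, fimg c (lsubmx y) ->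
     g (cot_inv c y) = k * y 0 (rshift (1 + n) (lshift n 0)) + K (drop_u y)) ->
  differentiable K w ->
  poisson_cot (G \o @mu R n B) g a =
    k * partial (lshift n (lshift n 0)) (G \o dual_inv c) w
    + coord_bracket (G \o dual_inv c) K w.
Proof.
move=> c w gE dK; rewrite /poisson_cot -/c.
have Ew : drop_u (cot_coord c a) = w by exact: drop_u_cot_coord.
set z := cot_coord c a in Ew *.
have iz : fimg c (lsubmx z).
  by rewrite /z /cot_coord row_mxKl; exact/fcoord_img/fdom_at.
have oz := lsubmx_open (n := 1 + n) (@fimg_open _ _ _ c).
have GE i : partial i ((G \o @mu R n B) \o cot_inv c) z =
    'D_(drop_u (delta_mx 0 i)) (G \o dual_inv c) w.
  rewrite -Ew -partial_drop_u; apply: near_eq_partial.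
  apply: (open_nbhs_near oz iz) => y iy.
  exact: (congr1 G (mu_cot_inv iy)).
have HE i : partial i (g \o cot_inv c) z =
    k * (i == rshift (1 + n) (lshift n 0))%:R + 'D_(drop_u (delta_mx 0 i)) K w.
  rewrite -(partial_coord _ _ z) -Ew -partial_drop_u.
  pose u (y : 'rV[R]_(1 + n + (1 + n))) : R := y 0 (rshift (1 + n) (lshift n 0)).
  have -> : partial i (g \o cot_inv c) z = partial i ((k \*: u) + (K \o drop_u)) z.
    apply: near_eq_partial; apply: (open_nbhs_near oz iz) => y iy.
    exact: gE iy.
  have du : derivable u z (delta_mx 0 i).
    exact/diff_derivable/differentiable_coord.
  rewrite /partial deriveD.
  - by rewrite deriveZ.
  - exact: derivableZ.
  - apply/diff_derivable/differentiable_comp; first exact: drop_u_diff.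
    by rewrite Ew.
rewrite big_split_ord /= big_ord1 !GE !HE.
rewrite drop_u_base drop_u_u !derive0 eqxx mul0r subr0 addr0 mulr1.
rewrite mulrC; congr (_ + _).
apply: eq_bigr => l _; rewrite !GE !HE drop_u_base drop_u_p eq_lrshift.
by rewrite (inj_eq (@rshift_inj _ _)) eq_rlshift !mulr0 !add0r.
Qed.

Lemma poisson_dualE (f g : dual B -> R) (b : dual B) : smooth_dual g ->
  let c := fchart_at b.1 in
  poisson_dual f g b =
  coord_bracket (f \o dual_inv c) (g \o dual_inv c) (dual_coord c b).
Proof.
case: b => e p sg c; rewrite /poisson_dual.
have Emu : mu (e, row_mx 0 p) = (e, p) by rewrite /mu /= row_mxKr.
apply: etrans (@poisson_cot_formula f (g \o @mu R n B) 0 (g \o dual_inv c) _ _ _) _.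
- by move=> y iy; rewrite mul0r add0r; exact: (congr1 g (mu_cot_inv iy)).
- by apply: smooth_differentiable (sg c) _; apply: fimg_row; exact: fdom_at.
- by rewrite mul0r add0r; exact: (congr1 _ (congr1 (dual_coord c) Emu)).
Qed.

(** The same formula with the base point as a variable, so that it applies
    to the image of a jet by the Legendre map. *)
Lemma poisson_dual_at (f g : dual B -> R) e (b : dual B) : smooth_dual g ->
  b.1 = e -> let c := fchart_at e in
  poisson_dual f g b =
  coord_bracket (f \o dual_inv c) (g \o dual_inv c) (dual_coord c b).
Proof. by move=> sg <-; exact: poisson_dualE. Qed.

Lemma poisson_dualC (f g : dual B -> R) (b : dual B) :
  smooth_dual f -> smooth_dual g -> poisson_dual f g b = - poisson_dual g f b.
Proof. by move=> sf sg; rewrite !poisson_dualE // coord_bracketC. Qed.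

Section HamiltonianSection.
Variable h : dual B -> cot B.
Hypothesis hmu : forall b, mu (h b) = b.
Hypothesis hsmooth : forall c, smooth_map_on [set z | fimg c (lsubmx z)]
  (cot_coord c \o h \o dual_inv c).

Lemma h_starE c (y : 'rV[R]_(1 + n + (1 + n))) : fimg c (lsubmx y) ->
  h_star h (cot_inv c y) = y 0 (rshift (1 + n) (lshift n 0)) + ham h c (drop_u y).
Proof.
move=> iy; pose e := finv c (lsubmx y).
have ce : fdom c e by exact: finv_dom.
have [_ _ aA] := fchart_at_inverse ce.
have Ey : y = row_mx (fcoord c e) (row_mx (lsubmx (rsubmx y)) (rsubmx (rsubmx y))).
  by rewrite hsubmxK /e finvK // hsubmxK.
rewrite /drop_u -(finvK iy) -/e (ham_at hmu _ ce) /h_star mu_cot_inv //.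
rewrite /drop_u -(finvK iy) -/e (dual_inv_at ce).
rewrite {1}Ey (cot_inv_at ce).
have -> : y 0 (rshift (1 + n) (lshift n 0)) = lsubmx (rsubmx y) 0 0 by rewrite !mxE.
move: (lsubmx (rsubmx y)) (rsubmx (rsubmx y)) => u p.
rewrite -(mulmxA p) -trmx_mul aA.
move: (h _).2 (fibre_driftV c e) => s d.
have -> : (lsubmx s + p *m (- d)^T) 0 0 = s 0 (lshift n 0) - (p *m d^T) 0 0.
  by rewrite linearN mulmxN !mxE.
rewrite [LHS]mxE row_mxEl [(- s) _ _]mxE [in LHS]mxE opprB.
by rewrite -addrA.
Qed.

Lemma poisson_h_star (G : dual B -> R) (a : cot B) :
  let c := fchart_at a.1 in let w := dual_coord c (mu a) in
  poisson_cot (G \o @mu R n B) (h_star h) a =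
    partial (lshift n (lshift n 0)) (G \o dual_inv c) w
    + coord_bracket (G \o dual_inv c) (ham h c) w.
Proof.
move=> c w; rewrite (@poisson_cot_formula _ _ 1 (ham h c)) ?mul1r //.
  by move=> y iy; rewrite mul1r; exact: h_starE.
apply: smooth_differentiable (ham_smooth hsmooth c) _.
by rewrite /= /w /dual_coord row_mxKl; exact/fcoord_img/fdom_at.
Qed.

Lemma poisson_h_star_at (G : dual B -> R) (a : cot B) e (b : dual B) :
  mu a = b -> a.1 = e ->
  let c := fchart_at e in let w := dual_coord c b in
  poisson_cot (G \o @mu R n B) (h_star h) a =
    partial (lshift n (lshift n 0)) (G \o dual_inv c) w
    + coord_bracket (G \o dual_inv c) (ham h c) w.
Proof. by move=> <- <-; exact: poisson_h_star. Qed.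

End HamiltonianSection.

End Brackets.

(** * The evolution operator and the Lagrangian constraints *)

Lemma sum_comb (R : comPzRingType) (I : finType) (l a b : I -> R) (x y : R) :
  \sum_i l i * (x * a i - y * b i) =
  x * (\sum_i l i * a i) - y * (\sum_i l i * b i).
Proof.
by rewrite !mulr_sumr -sumrB; apply: eq_bigr => i _; ring.
Qed.

Lemma sum_coordinates (R : realType) (n : nat) (F : 'I_(1 + n + n) -> R) :
  \sum_i F i = F (lshift n (lshift n 0)) + \sum_(k < n) F (lshift n (rshift 1 k))
               + \sum_(k < n) F (rshift (1 + n) k).
Proof. by rewrite big_split_ord big_split_ord /= big_ord1. Qed.

Lemma velocity_pairing (R : realType) (n : nat) (v q : 'rV[R]_n)
    (b : 'rV[R]_(1 + n + n)) :
  (row_mx (row_mx 1%:M v) q *m b^T) 0 0 =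
  b 0 (lshift n (lshift n 0))
  + \sum_(k < n) v 0 k * b 0 (lshift n (rshift 1 k))
  + \sum_(k < n) q 0 k * b 0 (rshift (1 + n) k).
Proof.
rewrite mxE sum_coordinates.
rewrite !row_mxEl 2!mxE eqxx mul1r; congr (_ + _ + _); apply: eq_bigr => k _.
  by rewrite row_mxEl row_mxEr mxE.
by rewrite row_mxEr mxE.
Qed.

Section Evolution.
Context {R : realType} {n m : nat} {B : fibre_bundle R n}.
Variables (L : jet B -> R) (phi : 'I_m -> dual B -> R) (h : dual B -> cot B).
Hypothesis sL : smooth_jet L.
Hypothesis phiP : complete_constraints L phi.
Hypothesis hP : hamiltonian_section L h.

Lemma legendre_coord_at (j : jet B) :
  dual_coord (fchart_at j.1) (legendre L j) =
  leg (L \o jet_inv (fchart_at j.1)) (jet_coord (fchart_at j.1) j).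
Proof.
case: j => e v; rewrite jet_coord_fchart_at.
have ie : fimg (fchart_at e) (lsubmx (row_mx (fcoord (fchart_at e) e) v)).
  by rewrite row_mxKl; exact/fcoord_img/fdom_at.
by rewrite -(legendre_coord sL ie) jet_inv_fchart_at.
Qed.

(** Substitute the velocities and the forces given by the multipliers in the
    definition of K. *)
Lemma evolution_multiplier (G : dual B -> R) (j : jet B) :
  evolution L G j =
    poisson_cot (G \o @mu R n B) (h_star h) (legendre_hat L j)
    + \sum_I jet_multiplier L phi h I j * poisson_dual G (phi I) (legendre L j).
Proof.
have alg (x y a b s t : R) :
  (a + s) * x + - (b + t) * y = x * a - y * b + (x * s - y * t) by ring.
have [hmu sh hL] := hP; have [sphi _ _ _] := phiP.
pose c := fchart_at j.1; pose z := jet_coord c j.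
pose w := dual_coord c (legendre L j).
have iz : fimg c (lsubmx z).
  by rewrite /z jet_coord_fchart_at row_mxKl; exact/fcoord_img/fdom_at.
have Ew : w = leg (L \o jet_inv c) z by exact: legendre_coord_at.
have [Eq Ev] := chart_defect sL phiP hP iz; rewrite -Ew in Eq Ev.
have Ej : rsubmx z = j.2 by rewrite /z jet_coord_fchart_at row_mxKr.
rewrite Ej in Ev.
pose Gc := G \o dual_inv c.
pose lam := multiplier (L \o jet_inv c) (ham h c) (chart_phi phi c) z.
have El I : jet_multiplier L phi h I j = lam 0 I by [].
have Eh : poisson_cot (G \o @mu R n B) (h_star h) (legendre_hat L j) =
    partial (lshift n (lshift n 0)) Gc w + coord_bracket Gc (ham h c) w.
  have muj : mu (legendre_hat L j) = legendre L j by rewrite hL hmu.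
  exact: (poisson_h_star_at hmu sh G muj (erefl : (legendre_hat L j).1 = j.1)).
have Eb I : poisson_dual G (phi I) (legendre L j) =
    coord_bracket Gc (phi I \o dual_inv c) w.
  exact: (@poisson_dual_at R n B G (phi I) j.1 (legendre L j) (sphi I) erefl).
have Vk k : j.2 0 k = partial (rshift (1 + n) k) (ham h c) w +
    \sum_I lam 0 I * partial (rshift (1 + n) k) (phi I \o dual_inv c) w.
  have /rowP/(_ k) := Ev; rewrite -/lam; move: (lam) => lam'.
  rewrite !mxE => /eqP; rewrite subr_eq addrC => /eqP ->; congr (_ + _).
  by apply: eq_bigr => I _; rewrite !mxE.
have Qk k : partial (lshift n (rshift 1 k)) (L \o jet_inv c) z =
    - (partial (lshift n (rshift 1 k)) (ham h c) w +
    \sum_I lam 0 I * partial (lshift n (rshift 1 k)) (phi I \o dual_inv c) w).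
  have /rowP/(_ (rshift 1 k)) := Eq; rewrite -/lam; move: (lam) => lam'.
  rewrite !mxE => /eqP; rewrite subr_eq addrC => /eqP E.
  rewrite -[LHS]opprK E; congr (- (_ + _)).
  by apply: eq_bigr => I _; rewrite !mxE.
have ES : \sum_I jet_multiplier L phi h I j * poisson_dual G (phi I) (legendre L j)
    = \sum_I lam 0 I * coord_bracket Gc (phi I \o dual_inv c) w.
  by apply: eq_bigr => I _; rewrite El Eb.
apply: etrans _ (esym (congr2 +%R Eh ES)).
rewrite /evolution -/c -/z -/w -/Gc -!addrA; congr (_ + _).
rewrite -big_split /= /coord_bracket.
under [X in _ = _ + X]eq_bigr => I _ do rewrite big_distrr /=.
rewrite exchange_big -big_split /=; apply: eq_bigr => k _.
rewrite Vk Qk.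
set Gq := partial (lshift n (rshift 1 k)) Gc w.
set Gp := partial (rshift (1 + n) k) Gc w.
set Hq := partial _ (ham h c) w; set Hp := partial _ (ham h c) w.
apply: etrans _ (congr1 _ (esym (sum_comb _ _ _ _ _))).
exact: alg.
Qed.

(** The q-components of i_Gamma Omega_L = 0: the momenta evolve under Gamma by
    the forces. *)
Lemma theta_force c (z : 'rV[R]_(1 + n + n)) (b : 'rV[R]_n) k :
  fimg c (lsubmx z) ->
  let Gam := row_mx (row_mx 1%:M (rsubmx z)) b in
  Gam *m Omega L c z = 0 ->
  (Gam *m 'J (vgrad (L \o jet_inv c)) z) 0 k =
  partial (lshift n (rshift 1 k)) (L \o jet_inv c) z.
Proof.
move=> iz Gam GO; set Lc := L \o jet_inv c; set kap := lshift n (rshift 1 k).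
have oP := @fimg_open _ _ _ c.
have dp : differentiable (vgrad Lc) z.
  exact: smooth_map_differentiable (vgrad_smooth oP (sL c)) iz.
have Tq l : (fun y => Theta L c y 0 (lshift n (rshift 1 l))) =
    (fun y => vgrad Lc y 0 l).
  by apply/funext => y; rewrite /Theta row_mxEl row_mxEr.
have Tv l : (fun y => Theta L c y 0 (rshift (1 + n) l)) = cst 0.
  by apply/funext => y; rewrite /Theta row_mxEr mxE.
pose E (y : 'rV[R]_(1 + n + n)) := \sum_i rsubmx y 0 i * vgrad Lc y 0 i - Lc y.
have Tt : (fun y => Theta L c y 0 (lshift n (lshift n 0))) = - E.
  apply/funext => y; rewrite /Theta 2!row_mxEl mxE eqxx mulr1n.
  by rewrite /E fctE opprB.
have dE : differentiable E z by exact: (energy_diff oP (sL c) iz).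
have GE : partial kap E z = - partial kap Lc z
    + \sum_l rsubmx z 0 l * partial kap (fun y => vgrad Lc y 0 l) z.
  have /rowP/(_ kap) := grad_energy oP (sL c) iz.
  rewrite [X in X = _]mxE => ->; rewrite [X in X = _]mxE row_mxEl.
  rewrite [X in X + _ = _]mxE [X in - X + _ = _]mxE.
  congr (_ + _); rewrite mxE; apply: eq_bigr => l _.
  by rewrite (jacobianE dp) 2![X in _ * X = _]mxE.
pose D i := partial kap (fun y => Theta L c y 0 i) z.
have JE i : 'J (vgrad Lc) z i k = partial i (fun y => Theta L c y 0 kap) z.
  by rewrite (jacobianE dp) mxE Tq.
have SD : \sum_i Gam 0 i * D i = partial kap Lc z.
  rewrite sum_coordinates /D Tt.
  under [X in _ + X + _]eq_bigr => l _ do rewrite Tq.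
  rewrite [X in _ + X = _]big1 ?addr0; last first.
    by move=> l _; rewrite Tv /partial derive_cst mulr0.
  have -> : partial kap (- E) z = - partial kap E z.
    exact/deriveN/diff_derivable.
  rewrite GE opprD opprK /Gam 2!row_mxEl mxE eqxx mul1r.
  under [X in _ + X = _]eq_bigr => l _ do rewrite row_mxEl row_mxEr.
  by rewrite subrK.
have : \sum_i Gam 0 i * D i - \sum_i Gam 0 i * 'J (vgrad Lc) z i k = 0.
  have /rowP/(_ kap) := GO; rewrite [LHS]mxE [RHS]mxE => G0.
  apply: etrans _ G0; rewrite -sumrB; apply: eq_bigr => i _.
  rewrite -mulrBr; congr (_ * _); rewrite JE /D /Omega /ext_d.
  by rewrite [RHS]mxE [X in _ = - X]mxE opprB.
by rewrite SD => /eqP; rewrite subr_eq0 => /eqP ->; rewrite mxE.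
Qed.

(** K.f is then the derivative along Gamma of the pullback of f by the Legendre
    map, which is zero. *)
Lemma evolution_lag_primary (f : dual B -> R) (j : jet B) : smooth_dual f ->
  (forall b, ham_primary L b -> f b = 0) -> lag_primary L j -> evolution L f j = 0.
Proof.
move=> sf f0 [b]; set c := fchart_at j.1; set z := jet_coord c j.
set Gam := row_mx _ b => GO.
have oP := @fimg_open _ _ _ c; have oU := lsubmx_open (n := n) oP.
have iz : fimg c (lsubmx z).
  by rewrite /z jet_coord_fchart_at row_mxKl; exact/fcoord_img/fdom_at.
pose Lc := L \o jet_inv c.
have Ew : dual_coord c (legendre L j) = leg Lc z by exact: legendre_coord_at.
have Ej : rsubmx z = j.2 by rewrite /z jet_coord_fchart_at row_mxKr.
have dp : differentiable (vgrad Lc) z.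
  exact: smooth_map_differentiable (vgrad_smooth oP (sL c)) iz.
have EL : Gam *m 'J (vgrad Lc) z =
    \row_k partial (lshift n (rshift 1 k)) Lc z.
  apply/rowP => k; rewrite [RHS]mxE.
  have := @theta_force c z b k iz; rewrite Ej; exact.
have dfc : differentiable (f \o dual_inv c) (leg Lc z).
  by apply: smooth_differentiable (sf c) _; exact: legU.
have D0 : 'D_Gam ((f \o dual_inv c) \o leg Lc) z = 0.
  rewrite (@near_eq_derive _ _ _ _ (fun=> 0)) ?derive_cst //.
  apply: (open_nbhs_near oU iz) => y iy.
  apply: (etrans (congr1 f (dual_inv_leg sL iy))); apply: f0.
  by exists (jet_inv c y).
have dl : differentiable (leg Lc) z by exact: leg_diff oP (sL c) _ iz.
rewrite (derive_grad _ (differentiable_comp dl dfc)) (grad_comp dl dfc) in D0.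
rewrite trmx_mul trmxK mulmxA (jacobian_leg oP (sL c) iz) mul_mx_row EL in D0.
rewrite mul_row_col mulmx1 mulmx0 addr0 velocity_pairing in D0.
rewrite -D0 /evolution -/c -/z Ew.
congr (_ + _ + _); first by rewrite mxE.
  by apply: eq_bigr => k _; rewrite mxE.
by apply: eq_bigr => k _; rewrite [X in _ = X * _]mxE [X in _ = _ * X]mxE.
Qed.

End Evolution.

(** * The evolution formula *)

Theorem proposition13 (R : realType) (n m1 m2 : nat) (B : fibre_bundle R n)
  (L : jet B -> R) (phi : 'I_(m1 + m2) -> dual B -> R) (h0 : dual B -> cot B) :
  smooth_jet L ->
  complete_constraints L phi ->
  first_class L phi ->
  second_class L phi ->
  hamiltonian_section L h0 ->
  (forall (al : 'I_m2) (b : dual B), ham_primary L b ->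
     lie_X h0 (phi (rshift m1 al)) b = 0) ->
  let M (j : jet B) : 'M[R]_m2 := invmx (bracket_matrix phi (legendre L j)) in
  let chi (al : 'I_m2) : jet B -> R := evolution L (phi (rshift m1 al)) in
  (exists nu : 'I_m1 -> jet B -> R,
     [/\ forall a, smooth_jet (nu a),
         forall a, ~ projectable L (nu a) &
         forall G : dual B -> R, smooth_dual G -> forall j : jet B,
           evolution L G j =
             poisson_cot (G \o @mu R n B) (h_star h0) (legendre_hat L j)
             + \sum_(be < m2) \sum_(al < m2)
                 M j be al * chi al j
                 * poisson_dual G (phi (rshift m1 be)) (legendre L j)
             + \sum_(a < m1)
                 nu a j
                 * poisson_dual G (phi (lshift m2 a)) (legendre L j)]) /\
  (forall (al : 'I_m2) (j : jet B), lag_primary L j -> chi al j = 0).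
Proof.
move=> sL phiP fc sc hP lieP M chi; have [sphi zero _ _] := phiP.
split; last first.
  move=> al j lj; apply: evolution_lag_primary (sphi _) _ lj => //.
  by move=> b /zero; exact.
pose lam := jet_multiplier L phi h0.
(* Apply the formula with multipliers to the second class constraints and solve
   the resulting linear system. *)
have lamE (be : 'I_m2) (j : jet B) :
    lam (rshift m1 be) j = \sum_al M j be al * chi al j.
  have Sj : ham_primary L (legendre L j) by exists j.
  have [_ _ hL] := hP.
  have chiE al : chi al j = \sum_ga bracket_matrix phi (legendre L j) al ga
                                    * lam (rshift m1 ga) j.
    rewrite /chi (evolution_multiplier sL phiP hP) hL.
    (* The term with the Hamiltonian section is lie_X h0 (phi al) at FL(j). *)
    rewrite [X in X + _](lieP al _ Sj) add0r big_split_ord /= big1 ?add0r.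
      by apply: eq_bigr => ga _; rewrite mxE mulrC.
    by move=> a _; rewrite poisson_dualC // fc // oppr0 mulr0.
  pose Lam := \col_ga lam (rshift m1 ga) j.
  have -> : lam (rshift m1 be) j =
      (M j *m (bracket_matrix phi (legendre L j) *m Lam)) be 0.
    by rewrite mulmxA mulVmx ?mul1mx ?mxE //; exact: sc.
  rewrite mxE; apply: eq_bigr => al _; rewrite chiE mxE.
  by congr (_ * _); apply: eq_bigr => ga _; rewrite [X in _ * X]mxE.
exists (fun a => lam (lshift m2 a)); split => [a|a|G sG j].
- exact: jet_multiplier_smooth.
- exact: jet_multiplier_not_projectable.
rewrite (evolution_multiplier sL phiP hP) -addrA; congr (_ + _).
rewrite big_split_ord /= addrC; congr (_ + _).
by apply: eq_bigr => be _; rewrite -mulr_suml -lamE.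
Qed.
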